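(* Let $m\ge1$, $n\ge2$ be integers with $\gcd(m,n)=1$, and consider the $C^*$-algebra $\mathcal{O}_{(m,n)}(\mathbb{T})$ generated by $z$ and $S_1$. Then for every $k\in\mathbb{N}$ (i.e. $k\ge1$) the $C^*$-subalgebra $C^*(z^k,S_1)$ of $\mathcal{O}_{(m,n)}(\mathbb{T})$ generated by $z^k$ and $S_1$ is isomorphic to $\mathcal{O}_{(m,n)}(\mathbb{T})$.
   Context: For positive integers $m,n$ with $\gcd(m,n)=1$, $\mathcal{O}_{(m,n)}(\mathbb{T})$ is the universal $C^*$-algebra generated by a unitary $z$ and isometries $S_1,\dots,S_n$ satisfying $zS_i=S_{i+1}$ ($1\le i\le n-1$), $zS_n=S_1z^m$, $\sum_{i=1}^nS_iS_i^*=1$. (Thus $S_i=z^{i-1}S_1$, and the algebra is generated by $z$ and $S_1$; the unitary $z$ has full spectrum $\mathbb{T}$.) *)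

(* Defs.v *)
From HB Require Import structures.
From mathcomp Require Import all_boot all_order all_algebra.
From mathcomp Require Import all_classical all_reals all_analysis.
From mathcomp Require Import complex.

Set Implicit Arguments.
Unset Strict Implicit.
Unset Printing Implicit Defensive.

Import Order.TTheory GRing.Theory Num.Theory numFieldNormedType.Exports.

Local Open Scope classical_set_scope.
Local Open Scope complex_scope.
Local Open Scope ring_scope.

(* Unital complex C*-algebras: a Banach space over R[i] (whose norm takes its
   values in R[i], as for every normed module over R[i]) with a product, a unit
   and an involution. This is not a Hierarchy Builder structure because
   MathComp has no join of its ring and normed-module hierarchies below
   numDomainType; the algebra structure is declared on the carrier instead. *)
Record cstarAlgType (R : realType) := CStarAlgType {
  cstar_space : completeNormedModType R[i];
  cstar_mul : cstar_space -> cstar_space -> cstar_space;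
  cstar_one : cstar_space;
  cstar_inv : cstar_space -> cstar_space;
  cstar_mulA : associative cstar_mul;
  cstar_mul1l : left_id cstar_one cstar_mul;
  cstar_mul1r : right_id cstar_one cstar_mul;
  cstar_mulDl : left_distributive cstar_mul +%R;
  cstar_mulDr : right_distributive cstar_mul +%R;
  cstar_one_neq0 : cstar_one != 0;
  cstar_scaleAl : forall (a : R[i]) x y,
    a *: cstar_mul x y = cstar_mul (a *: x) y;
  cstar_scaleAr : forall (a : R[i]) x y,
    a *: cstar_mul x y = cstar_mul x (a *: y);
  cstar_invK : involutive cstar_inv;
  cstar_invD : {morph cstar_inv : x y / x + y};
  cstar_invZ : forall (a : R[i]) x, cstar_inv (a *: x) = a^* *: cstar_inv x;
  cstar_invM : forall x y,
    cstar_inv (cstar_mul x y) = cstar_mul (cstar_inv y) (cstar_inv x);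
  cstar_normM_le : forall x y, `|cstar_mul x y| <= `|x| * `|y|;
  cstar_identity : forall x, `|cstar_mul (cstar_inv x) x| = `|x| ^+ 2
}.

Definition cstar_sort (R : realType) (A : cstarAlgType R) : Type :=
  cstar_space A.

Coercion cstar_sort : cstarAlgType >-> Sortclass.

HB.instance Definition _ (R : realType) (A : cstarAlgType R) :=
  CompleteNormedModule.copy (cstar_sort A) (cstar_space A).

HB.instance Definition _ (R : realType) (A : cstarAlgType R) :=
  GRing.Zmodule_isNzRing.Build (cstar_sort A) (@cstar_mulA R A)
    (@cstar_mul1l R A) (@cstar_mul1r R A) (@cstar_mulDl R A)
    (@cstar_mulDr R A) (@cstar_one_neq0 R A).

HB.instance Definition _ (R : realType) (A : cstarAlgType R) :=
  GRing.Lmodule_isLalgebra.Build R[i] (cstar_sort A) (@cstar_scaleAl R A).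

HB.instance Definition _ (R : realType) (A : cstarAlgType R) :=
  GRing.Lalgebra_isAlgebra.Build R[i] (cstar_sort A) (@cstar_scaleAr R A).

Definition star (R : realType) (A : cstarAlgType R) : A -> A := @cstar_inv R A.

Definition cstar_unitary (R : realType) (A : cstarAlgType R) (u : A) : Prop :=
  star u * u = 1 /\ u * star u = 1.

Definition cstar_isometry (R : realType) (A : cstarAlgType R) (s : A) : Prop :=
  star s * s = 1.

(* A C*-subalgebra is not required to contain the unit of A. *)
Record cstar_subalgebra (R : realType) (A : cstarAlgType R) (D : set A) :
    Prop := {
  csub0 : D 0;
  csubP : forall (a : R[i]) x y, D x -> D y -> D (a *: x + y);
  csubM : forall x y, D x -> D y -> D (x * y);
  csub_star : forall x, D x -> D (star x);
  csub_closed : closed D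
}.

Definition cstar_generated (R : realType) (A : cstarAlgType R) (G : set A) :
    set A :=
  smallest (@cstar_subalgebra R A) G.

(* Isomorphism of the C*-subalgebras D of A and E of B; the values of f
   outside D are irrelevant. *)
Definition cstar_isomorphic (R : realType) (A B : cstarAlgType R)
    (D : set A) (E : set B) : Prop :=
  exists f : A -> B,
    [/\ forall (a : R[i]) x y, D x -> D y -> f (a *: x + y) = a *: f x + f y,
        forall x y, D x -> D y -> f (x * y) = f x * f y,
        forall x, D x -> f (star x) = star (f x)
      & set_bij D E f].

(* The index i : 'I_n stands for the index i + 1 in S_1, ..., S_n. *)
Record Omn_relations (R : realType) (m n : nat) (A : cstarAlgType R)
    (z : A) (S : 'I_n -> A) : Prop := {
  Omn_unitary : cstar_unitary z;
  Omn_isometry : forall i, cstar_isometry (S i);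
  Omn_succ : forall i j : 'I_n, j = i.+1 :> nat -> z * S i = S j;
  Omn_last : forall i j : 'I_n, i = 0%N :> nat -> j.+1 = n ->
    z * S j = S i * z ^+ m;
  Omn_sum : \sum_(i < n) S i * star (S i) = 1
}.

(* (A, z, S) is the universal C*-algebra on Omn_relations; elements of
   {lrmorphism A -> B} are the unital algebra homomorphisms, and the one given
   by Omn_universal is unique by Omn_generated. *)
Record is_Omn (R : realType) (m n : nat) (A : cstarAlgType R)
    (z : A) (S : 'I_n -> A) : Prop := {
  Omn_rel : Omn_relations m z S;
  Omn_generated : cstar_generated ([set z] `|` range S) = [set: A];
  Omn_universal : forall (B : cstarAlgType R) (w : B) (T : 'I_n -> B),
    Omn_relations m w T ->
    exists f : {lrmorphism A -> B},
      [/\ forall x, f (star x) = star (f x),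
          f z = w
        & forall i, f (S i) = T i]
}.

(* Main.v *)
Require Import Defs.
From mathcomp Require Import all_boot all_order all_algebra.
From mathcomp Require Import all_classical all_reals all_analysis.
From mathcomp Require Import complex ring lra zify.

(** Write [S] for the first isometry, so that the algebra [A] is generated by a
  unitary [z] and an isometry [S] with [z^n S = S z^m] and with the range
  projections of [z^i S], [i < n], adding up to 1.

  Reduction to [k] prime to [n] ([reduce_coprime]).  If [p = gcd(k, n) > 1] and
  [k = p k1], then [z^(k1 n)] is a power of [z^k] and
  [S^* z^(k1 n) S = z^(k1 m)]; since [m] is prime to [p], the powers
  [z^(k1 m)] and [z^(k1 p) = z^k] give back [z^k1].  So [z^k] may be replaced
  by [z^k1] without changing the subalgebra.

  If [k] is prime to [n], the pair [(z^k, S)] satisfies the same relations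
  ([odometer_pow]: the projections on the ranges of [z^i S] depend only on [i]
  modulo [n], and [i |-> k i] permutes the residues).  Universality gives an
  endomorphism [f] with [f z = z^k] and [f S = S], and everything rests on [f]
  being isometric ([hom_isometric]): its range is then closed, hence equal to
  the subalgebra generated by [z^k] and [S].

  Homomorphisms of C*-algebras are contractive ([hom_contractive]).  The
  converse inequality is obtained by one device, used twice
  ([hom_expanding]): because the norm of [(x^* x)^(2^j)] is a power of that of
  [x], an estimate [|y| <= C (1 + E 2^j) |f y|] for [y = (x^* x)^(2^j)] already
  gives [|x| <= |f x|].  Crude bounds which grow only linearly in a degree are
  therefore enough.

  First use: elements of gauge degree 0 of a fixed level [l], which are matrices
  of Laurent polynomials in [z], indexed by the words of length [l] in the
  isometries.  A coefficient of a Laurent polynomial [p] can be read off from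
  [f p] by compressing with powers of [S], since [S^{*a} z^r S^a] vanishes
  unless [n^a] divides [r]; so the norm is at most the number of coefficients
  times the norm of the image ([laurent_bound], [entries_bound]).  As the level
  stays fixed under powers, the number of coefficients grows linearly.

  Second use: finite sums of elements of different gauge degrees.  The gauge
  automorphisms [z |-> z], [S |-> t S] for [|t| = 1] show that each homogeneous
  component of [f x] has norm at most [|f x|] ([coef_le_sup]), and homogeneous
  elements were treated by the first use, through [x^* x].  These finite sums
  are dense. *)

Set Implicit Arguments.
Unset Strict Implicit.
Unset Printing Implicit Defensive.
Import Order.TTheory GRing.Theory Num.Theory numFieldNormedType.Exports.
Local Open Scope classical_set_scope.
Local Open Scope complex_scope.
Local Open Scope ring_scope.

(** * The real-valued norm *)

Section RealNorm.
Context (R : realType) (A : cstarAlgType R).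
Implicit Types (x y : A) (c : R[i]).

(** The norm of [A] takes its values in the complex numbers; its real part is the
  same number in an ordered field, where linear arithmetic is available. *)
Definition nrm x : R := complex.Re `|x|.

Lemma nrmE x : `|x| = (nrm x)%:C.
Proof. by rewrite /nrm RRe_real // normr_real. Qed.

Lemma nrm_ge0 x : 0 <= nrm x.
Proof. by rewrite -lecR -nrmE normr_ge0. Qed.

Lemma nrm0_eq0 x : nrm x = 0 -> x = 0.
Proof. by move=> x0; apply: normr0_eq0; rewrite nrmE x0. Qed.

Lemma nrm0 : nrm 0 = 0. Proof. by rewrite /nrm normr0. Qed.

Lemma nrmN x : nrm (- x) = nrm x. Proof. by rewrite /nrm normrN. Qed.

Lemma nrmB x y : nrm (x - y) = nrm (y - x).
Proof. by rewrite -nrmN opprB. Qed.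

Lemma ler_nrmD x y : nrm (x + y) <= nrm x + nrm y.
Proof. by rewrite -lecR rmorphD /= -!nrmE ler_normD. Qed.

Lemma ler_nrmM x y : nrm (x * y) <= nrm x * nrm y.
Proof. by rewrite -lecR rmorphM /= -!nrmE; exact: cstar_normM_le. Qed.

Lemma nrmZ c x : nrm (c *: x) = complex.Re `|c| * nrm x.
Proof.
apply/complexI; rewrite -nrmE normrZ nrmE rmorphM /=.
by congr (_ * _); rewrite [RHS]RRe_real // normr_real.
Qed.

Lemma nrmZ_unit c x : `|c| = 1 -> nrm (c *: x) = nrm x.
Proof. by move=> c1; rewrite nrmZ c1 mul1r. Qed.

Lemma nrmZ_real (r : R) x : 0 <= r -> nrm (r%:C *: x) = r * nrm x.
Proof. by move=> r0; rewrite nrmZ ger0_norm ?ler0c. Qed.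

Lemma ler_nrm_sum (I : Type) (s : seq I) (P : pred I) (F : I -> A) :
  nrm (\sum_(i <- s | P i) F i) <= \sum_(i <- s | P i) nrm (F i).
Proof.
elim/big_ind2: _ => //; first by rewrite nrm0.
by move=> x1 x2 y1 y2 h1 h2; apply: le_trans (ler_nrmD _ _) (lerD h1 h2).
Qed.

Lemma starK x : star (star x) = x. Proof. exact: cstar_invK. Qed.
Lemma starD x y : star (x + y) = star x + star y. Proof. exact: cstar_invD. Qed.
Lemma starZ c x : star (c *: x) = c^* *: star x. Proof. exact: cstar_invZ. Qed.
Lemma starM x y : star (x * y) = star y * star x. Proof. exact: cstar_invM. Qed.
Lemma star0 : star (0 : A) = 0.
Proof. by apply: (addrI (star 0)); rewrite -starD !addr0. Qed.
Lemma starN x : star (- x) = - star x.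
Proof. by apply: (addrI (star x)); rewrite -starD !subrr star0. Qed.
Lemma star1 : star (1 : A) = 1.
Proof. by rewrite -[LHS]mulr1 -[X in _ * X]starK -starM mulr1 starK. Qed.
Lemma starX x j : star (x ^+ j) = star x ^+ j.
Proof. by elim: j => [|j IH]; rewrite ?expr0 ?star1 // exprSr starM IH exprS. Qed.
Lemma star_sum (I : Type) (s : seq I) (P : pred I) (F : I -> A) :
  star (\sum_(i <- s | P i) F i) = \sum_(i <- s | P i) star (F i).
Proof. by elim/big_rec2: _ => [|i x y _ <-]; rewrite ?star0 ?starD. Qed.

Lemma cstar_nrm x : nrm (star x * x) = nrm x ^+ 2.
Proof. by apply/complexI; rewrite rmorphXn /= -!nrmE; exact: cstar_identity. Qed.

Lemma nrm_star x : nrm (star x) = nrm x.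
Proof.
suff le_star y : nrm y <= nrm (star y).
  by apply/eqP; rewrite eq_le le_star -{2}[x]starK le_star.
have [->|y0] := eqVneq (nrm y) 0; first exact: nrm_ge0.
have yp : 0 < nrm y by rewrite lt_def y0 nrm_ge0.
by rewrite -(ler_pM2r yp) -expr2 -cstar_nrm ler_nrmM.
Qed.

Lemma nrm_isometry x : cstar_isometry x -> nrm x = 1.
Proof.
have nrm1 : nrm (1 : A) = 1.
  have : nrm (1 : A) ^+ 2 = nrm (1 : A) by rewrite -cstar_nrm star1 mulr1.
  have n1 : nrm (1 : A) != 0.
    by apply/eqP => /nrm0_eq0 /eqP; rewrite oner_eq0.
  by rewrite expr2 -{3}[nrm 1]mulr1 => /(mulfI n1).
move=> sx; apply/eqP; rewrite -(@eqrXn2 _ 2) ?nrm_ge0 // -cstar_nrm.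
by rewrite (_ : star x * x = 1) // nrm1 expr1n.
Qed.

Lemma nrm1 : nrm (1 : A) = 1.
Proof. by apply: nrm_isometry; rewrite /cstar_isometry star1 mulr1. Qed.

(** The C*-identity iterated: [x^* x] is self-adjoint, so squaring it squares its
  norm. *)
Lemma nrm_sqpow x j :
  nrm ((star x * x) ^+ (2 ^ j)) = (nrm x ^+ 2) ^+ (2 ^ j).
Proof.
elim: j => [|j IH]; first by rewrite expn0 !expr1 cstar_nrm.
rewrite expnSr [in RHS]exprM -IH -cstar_nrm exprM expr2.
by rewrite starX starM starK.
Qed.

Lemma nrm_eps_eq x y (K : R) :
  (forall e, 0 < e -> nrm (x - y) <= K * e) -> x = y.
Proof.
move=> small; apply/subr0_eq/nrm0_eq0/eqP; rewrite eq_le nrm_ge0 andbT.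
apply/ler_addgt0Pr => e e0; rewrite add0r.
have K0 : 0 < `|K| + 1 by rewrite ltr_wpDl.
apply: le_trans (small (e / (`|K| + 1)) (divr_gt0 e0 K0)) _.
rewrite mulrA ler_pdivrMr // mulrC ler_pM2l //.
by apply: le_trans (ler_norm _) _; rewrite lerDl.
Qed.

Definition nrm_lim (u : nat -> A) l :=
  forall e, 0 < e -> exists N : nat, forall p, (N <= p)%N -> nrm (u p - l) < e.

Lemma nrm_complete (u : nat -> A) :
  (forall e, 0 < e -> exists N : nat, forall p q, (N <= p)%N -> (N <= q)%N ->
     nrm (u p - u q) < e) -> exists l, nrm_lim u l.
Proof.
move=> cu.
have cR (e : R[i]) : 0 < e -> e = (complex.Re e)%:C /\ 0 < complex.Re e.
  move=> e0; have ee : e = (complex.Re e)%:C by rewrite RRe_real // gtr0_real.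
  by split=> //; rewrite -ltcR -ee.
have : cauchy (u @ \oo).
  apply/cauchy_ballP => e /cR [ee e0]; have [N HN] := cu _ e0.
  exists (u @` [set p | (N <= p)%N], u @` [set p | (N <= p)%N]).
    by split; exists N => // p Np; exists p.
  move=> [_ _] /= [[p Np <-] [q Nq <-]].
  by rewrite -ball_normE /= nrmE ee ltcR HN.
move/cauchy_cvgP/cvg_ex => [l ul]; exists l => e e0.
have eC : 0 < e%:C by rewrite ltcR.
have /cvgrPdist_lt /(_ _ eC) [N _ HN] := ul.
by exists N => p Np; rewrite nrmB -ltcR -nrmE; exact: HN.
Qed.

Lemma closed_nrm (D : set A) :
  (forall x, (forall e, 0 < e -> exists2 y, D y & nrm (x - y) < e) -> D x) ->
  closed D.
Proof.
move=> HD x clx; apply: HD => e e0.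
have eC : 0 < e%:C by rewrite ltcR.
have [y [Dy xy]] := clx _ (nbhsx_ballx x _ eC).
by exists y => //; rewrite -ltcR -nrmE; move: xy; rewrite -ball_normE.
Qed.

Lemma closed_nrm_limit (D : set A) x : closed D ->
  (forall e, 0 < e -> exists2 y, D y & nrm (x - y) < e) -> D x.
Proof.
move=> Dcl Hx; apply: Dcl => B /nbhs_ballP [e /= e0 eB].
have eE : e = (complex.Re e)%:C by rewrite RRe_real // gtr0_real.
have [|y Dy xy] := Hx (complex.Re e); first by rewrite -ltcR -eE.
by exists y; split=> //; apply: eB; rewrite -ball_normE /= nrmE eE ltcR.
Qed.

End RealNorm.

(** A factor growing linearly in the exponent is invisible to the exponential: if
  [a > b] then [(a / b)^(2^j)] grows at least like the square of [2^j]. *)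
Lemma ler_of_pow_ler (R : realType) (a b C E : R) :
  0 <= a -> 0 <= b -> 0 <= C -> 0 <= E ->
  (forall j, a ^+ (2 ^ j) <= C * (1 + E * (2 ^ j)%:R) * b ^+ (2 ^ j)) -> a <= b.
Proof.
move=> a0 b0 C0 E0 H; rewrite leNgt; apply/negP => ba.
have bp : 0 < b.
  rewrite lt_def b0 andbT; apply/negP => /eqP b00.
  by have := H 0%N; rewrite expn0 !expr1 b00 mulr0 leNgt -b00 ba.
pose h := a / b - 1.
have h0 : 0 < h by rewrite subr_gt0 ltr_pdivlMr // mul1r.
pose K := 4 * C * (1 + E) / h ^+ 2.
have E1 : 0 <= 1 + E by rewrite addr_ge0.
have K0 : 0 <= K.
  by apply: divr_ge0; [rewrite !mulr_ge0|rewrite exprn_ge0 ?ltW].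
have bern N : 1 + N%:R * h <= (1 + h) ^+ N.
  elim: N => [|N IH]; first by rewrite expr0 mul0r addr0.
  rewrite exprS; apply: le_trans (ler_wpM2l _ IH); last by rewrite addr_ge0 // ltW.
  rewrite -natr1; have : 0 <= N%:R * h * h by rewrite -mulrA mulr_ge0 // mulr_ge0 // ltW.
  lra.
pose j := Num.bound K; have Kj := archi_boundP K0; rewrite -/j in Kj.
have jj : (j <= 2 ^ j)%N by exact/ltnW/ltn_expl.
have := H j.+1.
have e2 : a ^+ (2 ^ j.+1) = b ^+ (2 ^ j.+1) * ((1 + h) ^+ (2 ^ j)) ^+ 2.
  by rewrite -exprM -expnSr -exprMn /h subrKC mulrC divfK // gt_eqF.
rewrite e2 mulrC ler_pM2r ?exprn_gt0 // expnS.
have := bern (2 ^ j)%N; move: (2 ^ j)%N jj => N jN bN.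
apply/negP; rewrite -ltNge.
have KN : K < N%:R by apply: lt_le_trans Kj _; rewrite ler_nat.
have N1 : 1 <= N%:R :> R.
  by rewrite ler1n; case: N KN {jN bN} => //; rewrite ltNge K0.
have Nh : 0 <= N%:R * h by apply: mulr_ge0 => //; exact: ltW.
have {}bN : (N%:R * h) ^+ 2 <= ((1 + h) ^+ N) ^+ 2.
  have bN' : N%:R * h <= (1 + h) ^+ N by apply: le_trans bN; rewrite lerDr.
  by rewrite ler_pXn2r // nnegrE // (le_trans Nh).
apply: lt_le_trans bN; move: KN; rewrite /K ltr_pdivrMr ?exprn_gt0 // => KN.
have : N%:R * (4 * C * (1 + E)) < N%:R * (N%:R * h ^+ 2).
  by rewrite ltr_pM2l // (lt_le_trans ltr01).
have CE : 0 <= C * E by exact: mulr_ge0.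
have CN : 0 <= C * (N%:R - 1) by rewrite mulr_ge0 // subr_ge0.
have CEN : 0 <= C * E * N%:R by exact: mulr_ge0.
rewrite natrM exprMn; move: KN; nra.
Qed.

(** * Square roots by a fixed-point iteration *)

Section SquareRoot.
Context (R : realType) (A : cstarAlgType R) (h : A).
Hypotheses (star_h : star h = h) (h_small : nrm h ^+ 2 <= 3 / 4).

Let half : R[i] := (2^-1 : R)%:C.
Let step (y : A) := half *: (h * h + y * y).
Let y j := iter j step 0.

Let nrm_half (x : A) : nrm (half *: x) = 2^-1 * nrm x.
Proof. by rewrite nrmZ_real // invr_ge0. Qed.

Let y_small j : nrm (y j) <= 2^-1.
Proof.
elim: j => [|j IH]; first by rewrite nrm0 invr_ge0.
rewrite [y _]/(step (y j)) nrm_half.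
have := ler_nrmD (h * h) (y j * y j).
have := ler_nrmM h h; have := ler_nrmM (y j) (y j).
move: h_small IH (nrm_ge0 (y j)); rewrite expr2; nra.
Qed.

Let y_star j : star (y j) = y j.
Proof.
elim: j => [|j IH]; first exact: star0.
rewrite [y j.+1]/(step (y j)) /step starZ starD !starM IH star_h.
by rewrite conj_Creal // complex_real.
Qed.

Let y_comm j : y j * h = h * y j.
Proof.
elim: j => [|j IH]; first by rewrite mulr0 mul0r.
rewrite [y j.+1]/(step (y j)) /step -scalerAl -scalerAr mulrDl mulrDr.
by rewrite -(mulrA (y j)) IH mulrA IH !mulrA.
Qed.

Let sqrB (u v : A) : u * u - v * v = u * (u - v) + (u - v) * v.
Proof. by rewrite mulrBr mulrBl addrA subrK. Qed.

Let addBdl (w u v : A) : w + u - (w + v) = u - v.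
Proof. by rewrite opprD addrACA subrr add0r. Qed.

Let y_cauchy j d : nrm (y (j + d) - y j) <= 2^-1 ^+ j.
Proof.
elim: j => [|j IH].
  rewrite add0n expr0 [y 0%N]/(0 : A) subr0; apply: le_trans (y_small d) _.
  by rewrite invf_le1 ?ler1n.
rewrite addSn [y (j + d).+1]/(step (y (j + d))) [y j.+1]/(step (y j)).
rewrite /step -scalerBr nrm_half addBdl sqrB exprS ler_wpM2l ?invr_ge0 //.
apply: le_trans (ler_nrmD _ _) _.
set u := y (j + d); set v := y j.
have := ler_nrmM u (u - v); have := ler_nrmM (u - v) v.
have := y_small (j + d); have := y_small j; rewrite -/u -/v.
move: IH (nrm_ge0 (u - v)); rewrite -/u -/v; nra.
Qed.

(** The map [y |-> (h^2 + y^2) / 2] contracts the ball of radius 1/2; its fixed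
  point [l] satisfies [(1 - l)^2 = 1 - h^2].  The iterates stay self-adjoint and
  commute with [h], and both properties pass to the limit. *)
Lemma exists_sqrt :
  exists c : A, [/\ star c = c, c * h = h * c & c * c = 1 - h * h].
Proof.
have [l yl] : exists l, nrm_lim y l.
  apply: nrm_complete => e e0.
  have [N HN] : exists N, (2^-1 : R) ^+ N < e.
    have /cvgrPdist_lt /(_ _ e0) [N _ HN] : (fun N => (2^-1 : R) ^+ N) @ \oo --> (0 : R).
      by apply: cvg_expr; rewrite ger0_norm ?invr_ge0 // invf_lt1 ?ltr1n.
    exists N; have := HN N (leqnn N); rewrite /= sub0r normrN ger0_norm //.
  have HN2 p q : (N <= p)%N -> (p <= q)%N -> nrm (y q - y p) < e.
    move=> Np pq; rewrite -(subnKC pq); apply: le_lt_trans (y_cauchy _ _) _.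
    apply: le_lt_trans HN.
    by apply: ler_wiXn2l => //; rewrite ?invr_ge0 // invf_le1 ?ler1n.
  exists N => p q Np Nq; case: (leqP p q) => [pq|/ltnW qp].
    by rewrite nrmB HN2.
  exact: HN2.
have sl : star l = l.
  apply: (@nrm_eps_eq _ _ _ _ 2) => e /yl [N /(_ N (leqnn N)) yN].
  rewrite -(subrKA (y N)) -{1}[y N]y_star -starN -starD.
  apply: le_trans (ler_nrmD _ _) _; rewrite nrm_star nrmB; lra.
have cl : l * h = h * l.
  apply: (@nrm_eps_eq _ _ _ _ (2 * nrm h)) => e /yl [N /(_ N (leqnn N)) yN].
  have -> : l * h - h * l = h * (y N - l) - (y N - l) * h.
    by rewrite mulrBr mulrBl y_comm opprB [RHS]addrC addrA subrK.
  apply: le_trans (ler_nrmD _ _) _; rewrite nrmN.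
  have := ler_nrmM h (y N - l); have := ler_nrmM (y N - l) h.
  have := nrm_ge0 h; nra.
have fl : l = step l.
  apply: (@nrm_eps_eq _ _ _ _ (2 + nrm l)) => e /yl [N HN].
  have := HN N.+1 (leqnSn N); have := HN N (leqnn N) => yN yN1.
  rewrite -(subrKA (y N.+1)); apply: le_trans (ler_nrmD _ _) _.
  rewrite nrmB [y N.+1]/(step (y N)) /step -scalerBr nrm_half addBdl sqrB.
  rewrite -/(step (y N)) -[step (y N)]/(y N.+1).
  have := ler_nrmD (y N * (y N - l)) ((y N - l) * l).
  have := ler_nrmM (y N) (y N - l); have := ler_nrmM (y N - l) l.
  have := nrm_ge0 l; have := nrm_ge0 (y N - l); have := y_small N.
  move: yN yN1 (nrm_ge0 (y N)); nra.
exists (1 - l); split; first by rewrite starD starN star1 sl.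
  by rewrite mulrBl mulrBr mul1r mulr1 cl.
have dl : h * h + l * l = l + l.
  rewrite -[l + l]mulr2n {3}fl /step -scaler_nat scalerA.
  rewrite /half -(rmorph_nat (real_complex R)) -rmorphM /= divff ?pnatr_eq0 //.
  by rewrite scale1r.
have hh : h * h = l + l - l * l by rewrite -dl addrK.
by rewrite hh mulrBl mul1r mulrBr mulr1 -addrA -opprD addrA.
Qed.

End SquareRoot.

(** * Norm estimates for homomorphisms *)

Section Homomorphisms.
Context (R : realType) (A B : cstarAlgType R) (f : {lrmorphism A -> B}).
Hypothesis fstar : forall x, f (star x) = star (f x).

(** With [c] a square root of [1 - h^2], the element [f h + i f c] is unitary and
  [f h] is its real part.  The argument transports algebraic relations only, so it
  applies to an [f] that is not known to be continuous. *)
Lemma hom_selfadjoint_le1 (h : A) : star h = h -> nrm h ^+ 2 <= 3 / 4 -> nrm (f h) <= 1.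
Proof.
move=> hs h34; have [c [cs cc csq]] := exists_sqrt hs h34.
pose i : R[i] := 'i.
have fh : star (f h) = f h by rewrite -fstar hs.
have fc : star (f c) = f c by rewrite -fstar cs.
have ii : i * i = -1 by rewrite -expr2 sqrCi.
pose u := f h + i *: f c.
have su : star u = f h - i *: f c.
  by rewrite starD starZ fh fc conjCi scaleNr.
have uu : star u * u = 1.
  rewrite su mulrBl !mulrDr -!scalerAl -!scalerAr scalerA ii scaleN1r.
  rewrite -!rmorphM cc csq !rmorphB rmorph1 /= opprD opprK.
  by rewrite addrA addrK addrCA subrr addr0.
have nu : nrm u = 1 by exact: nrm_isometry.
have -> : f h = (2^-1 : R)%:C *: (u + star u).
  rewrite su addrACA subrr addr0 -mulr2n -(scaler_nat 2 (f h)) scalerA.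
  rewrite -(rmorph_nat (real_complex R)) -rmorphM /= mulVf ?pnatr_eq0 //.
  by rewrite scale1r.
rewrite nrmZ_real ?invr_ge0 //.
have := ler_nrmD u (star u); rewrite nrm_star nu; lra.
Qed.

Lemma hom_selfadjoint_bounded (h : A) : star h = h -> nrm (f h) <= 2 * nrm h.
Proof.
move=> hs; have [/nrm0_eq0 ->|h0] := eqVneq (nrm h) 0.
  by rewrite rmorph0 !nrm0 mulr0.
have hp : 0 < nrm h by rewrite lt_def h0 nrm_ge0.
pose r := (2 * nrm h)^-1.
have r0 : 0 < r by rewrite invr_gt0 mulr_gt0.
have gs : star (r%:C *: h) = r%:C *: h.
  by rewrite starZ hs conj_Creal // complex_real.
have := hom_selfadjoint_le1 gs; rewrite linearZ /= !nrmZ_real ?(ltW r0) //.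
have -> : r * nrm h = 2^-1 by rewrite /r invfM -mulrA mulVf // mulr1.
have : r * nrm (f h) <= 1 -> nrm (f h) <= 2 * nrm h.
  by rewrite /r mulrC ler_pdivrMr ?mul1r // mulr_gt0.
move=> H1 H2; apply: H1; apply: H2; lra.
Qed.

Lemma star_sqpow (C : cstarAlgType R) (x : C) j :
  star ((star x * x) ^+ j) = (star x * x) ^+ j.
Proof. by rewrite starX starM starK. Qed.

Lemma hom_sqpow (x : A) j :
  f ((star x * x) ^+ j) = (star (f x) * f x) ^+ j.
Proof. by rewrite rmorphXn rmorphM /= fstar. Qed.

(** The boundedness with constant 2 improves to contractivity by taking the
  powers [(x^* x)^(2^j)]. *)
Lemma hom_contractive (x : A) : nrm (f x) <= nrm x.
Proof.
rewrite -(@ler_pXn2r _ 2) ?nnegrE ?nrm_ge0 //.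
apply: (@ler_of_pow_ler _ _ _ 2 0) => //; rewrite ?exprn_ge0 ?nrm_ge0 // => j.
rewrite mul0r addr0 mulr1 -!nrm_sqpow -hom_sqpow.
exact/hom_selfadjoint_bounded/star_sqpow.
Qed.

(** The reason why bounds that are linear in the degree suffice for an isometry. *)
Lemma hom_expanding (x : A) (C E : R) : 0 <= C -> 0 <= E ->
  (forall j, nrm ((star x * x) ^+ (2 ^ j)) <=
     C * (1 + E * (2 ^ j)%:R) * nrm (f ((star x * x) ^+ (2 ^ j)))) ->
  nrm x <= nrm (f x).
Proof.
move=> C0 E0 H; rewrite -(@ler_pXn2r _ 2) ?nnegrE ?nrm_ge0 //.
apply: (ler_of_pow_ler _ _ C0 E0); rewrite ?exprn_ge0 ?nrm_ge0 // => j.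
by rewrite -!nrm_sqpow -hom_sqpow.
Qed.

End Homomorphisms.

(** * Coefficients of polynomials on the unit circle, and orthogonality *)

Section Extremality.
Context (R : realType) (A : cstarAlgType R).

(** The witness separating the exponents [d] and [e]: averaging over the
  substitutions [t |-> t] and [t |-> w t], the latter with weight [w^(-d)], kills
  the exponent [e] and keeps [d]. *)
Lemma exists_root_neg (d e : nat) : d != e ->
  exists w : R[i], `|w| = 1 /\ w ^+ e = - w ^+ d.
Proof.
wlog de : d e / (d < e)%N => [wl|_].
  rewrite neq_ltn => /orP[de|ed]; first by apply: wl; rewrite ?neq_ltn ?de.
  have [|w [w1 we]] := wl _ _ ed; first by rewrite neq_ltn ed.
  by exists w; rewrite we opprK.
have ed0 : (0 < e - d)%N by rewrite subn_gt0.
exists ((e - d).-root (-1)); split.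
  by rewrite norm_rootC normrN1 rootC1.
by rewrite -{2}(subnK (ltnW de)) exprD rootCK // mulN1r.
Qed.

(** A polynomial on the unit circle bounds its coefficients.  Instead of
  integrating, the unwanted exponents are killed one after the other by averages
  that do not increase the supremum. *)
Lemma coef_le_sup_seq (K : R) (s : seq nat) (v : nat -> A) : uniq s ->
  (forall t : R[i], `|t| = 1 -> nrm (\sum_(c <- s) t ^+ c *: v c) <= K) ->
  forall d, d \in s -> nrm (v d) <= K.
Proof.
have [k] := ubnP (size s); elim: k => // k IH in s v *.
rewrite ltnS => sk us Hs d ds.
case: (boolP (all (pred1 d) s)) => [alld|/allPn [e es /= ed]].
  have sd : s = [:: d].
    case: s us alld ds {sk Hs} => // a s /= /andP[as_ us] /andP[/eqP ad alls] _.
    rewrite ad; case: s alls us as_ => // b s /= /andP[/eqP -> _] _.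
    by rewrite ad inE eqxx.
  have := Hs 1 (normr1 _).
  by rewrite sd big_seq1 expr1n scale1r.
have [w [w1 we]] : exists w : R[i], `|w| = 1 /\ w ^+ e = - w ^+ d.
  by apply: exists_root_neg; rewrite eq_sym.
have w0 : w != 0 by rewrite -normr_eq0 w1 oner_eq0.
pose v' c := (2^-1 : R)%:C *: ((1 + w ^- d * w ^+ c) *: v c).
have v'd : v' d = v d.
  rewrite /v' mulVf ?expf_neq0 // scalerA.
  rewrite -(rmorph1 (real_complex R)) -rmorphD -rmorphM /= mulVf ?scale1r //.
rewrite -v'd; apply: (IH (rem e s)); last 1 first.
- by rewrite mem_rem_uniq // inE eq_sym ed.
- by rewrite size_rem // prednK //; case: (s) es.
- exact: rem_uniq.
move=> t t1.
have -> : \sum_(c <- rem e s) t ^+ c *: v' c =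
    (2^-1 : R)%:C *: (\sum_(c <- s) t ^+ c *: v c +
                      w ^- d *: \sum_(c <- s) (w * t) ^+ c *: v c).
  rewrite scaler_sumr -big_split scaler_sumr [RHS](big_rem e) //=.
  rewrite exprMn we mulNr scaleNr scalerN scalerA mulKf ?expf_neq0 //.
  rewrite subrr scaler0 add0r; apply: eq_bigr => c _.
  rewrite /v' scalerA [t ^+ c * _]mulrC -scalerA; congr (_ *: _).
  rewrite !scalerA exprMn -scalerDl mulrDr mulr1.
  by rewrite mulrCA [t ^+ c * w ^+ c]mulrC.
rewrite nrmZ_real ?invr_ge0 //.
have := Hs _ t1; have := Hs (w * t); rewrite normrM w1 t1 mulr1 => /(_ erefl).
set a := \sum_(c <- s) _; set b := \sum_(c <- s) _ => Ha Hb.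
have := ler_nrmD b (w ^- d *: a); rewrite nrmZ_unit; first by lra.
by rewrite normfV normrX w1 expr1n invr1.
Qed.

Lemma coef_le_sup (K : R) (N : nat) (v : nat -> A) :
  (forall t : R[i], `|t| = 1 -> nrm (\sum_(c < N) t ^+ c *: v c) <= K) ->
  forall d, (d < N)%N -> nrm (v d) <= K.
Proof.
move=> H d dN; apply: (@coef_le_sup_seq K (iota 0 N)) (iota_uniq _ _) _ _ _.
  by move=> t /H; rewrite -(big_mkord xpredT (fun c => t ^+ c *: v c)) /index_iota subn0.
by rewrite mem_iota.
Qed.

(** The unit is an extreme point of the unit ball.  By convexity and the
  C*-identity [1 + (t / 2) x] has norm at most 1 for all complex [t] of modulus
  1; hence so has its [N]-th power, whose linear coefficient [(N / 2) x] is
  therefore bounded by 1, for every [N]. *)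
Lemma one_extreme_point (x : A) : star x = x ->
  nrm (1 + x) <= 1 -> nrm (1 - x) <= 1 -> x = 0.
Proof.
move=> sx xp xm.
have halfD (y : A) : (2^-1 : R)%:C *: (y + y) = y.
  rewrite -mulr2n -(scaler_nat 2 y) scalerA -(rmorph_nat (real_complex R)).
  by rewrite -rmorphM /= mulVf ?pnatr_eq0 // scale1r.
have avg (y z : A) : nrm y <= 1 -> nrm z <= 1 ->
    nrm ((2^-1 : R)%:C *: (y + z)) <= 1.
  by move=> y1 z1; rewrite nrmZ_real ?invr_ge0 //; have := ler_nrmD y z; lra.
have sq_le1 : nrm (1 + x * x) <= 1.
  have -> : 1 + x * x =
      (2^-1 : R)%:C *: ((1 + x) * (1 + x) + (1 - x) * (1 - x)).
    rewrite -[LHS]halfD; congr (_ *: _).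
    rewrite !mulrDl !mulrDr !mul1r !mulr1 mulrNN.
    rewrite [x + x * x]addrC [- x + x * x]addrC.
    rewrite [1 + x + _]addrACA [1 - x + _]addrACA [RHS]addrACA.
    by rewrite (addrACA x) subrr addr0 addr0.
  apply: avg; (apply: le_trans (ler_nrmM _ _) _).
    by rewrite mulr_ile1 ?nrm_ge0.
  by rewrite mulr_ile1 ?nrm_ge0.
have i_le1 (s : R[i]) : s * s = -1 -> s^* = - s -> nrm (1 + s *: x) <= 1.
  move=> ss sc; rewrite -(@expr_le1 _ 2) ?nrm_ge0 // -cstar_nrm.
  rewrite starD starZ star1 sx sc scaleNr mulrDr mulr1 mulrBl mul1r.
  by rewrite -scalerAl -scalerAr scalerA ss scaleN1r opprK addrA subrK.
have seg (y : A) (r : R) : nrm (1 + y) <= 1 -> nrm (1 - y) <= 1 ->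
    `|r| <= 1 -> nrm (1 + r%:C *: y) <= 1.
  move=> y1 y2; rewrite ler_norml => /andP[r1 r2].
  have -> : 1 + r%:C *: y = ((1 + r) / 2)%:C *: (1 + y) + ((1 - r) / 2)%:C *: (1 - y).
    rewrite !scalerDr scalerN addrACA -scalerDl -scalerBl -rmorphD -rmorphB.
    have -> : (1 + r) / 2 + (1 - r) / 2 = 1 by field.
    have -> : (1 + r) / 2 - (1 - r) / 2 = r by field.
    by rewrite rmorph1 scale1r.
  apply: le_trans (ler_nrmD _ _) _; rewrite !nrmZ_real; nra.
have disc (t : R[i]) : `|t| = 1 -> nrm (1 + ((2^-1 : R)%:C * t) *: x) <= 1.
  move=> t1; rewrite [t]complexE.
  have Rt : `|complex.Re t| <= 1.
    by rewrite -lecR -[X in _ <= X]t1; exact: normc_ge_Re.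
  have It : `|complex.Im t| <= 1.
    have := normc_ge_Re (t * 'i%C); rewrite normrM t1 mul1r ReiNIm normrN.
    by rewrite complexiE normCi lecR.
  have -> : 1 + ((2^-1 : R)%:C * ((complex.Re t)%:C + 'i%C * (complex.Im t)%:C)) *: x
     = (2^-1 : R)%:C *: ((1 + (complex.Re t)%:C *: x) +
             (1 + (complex.Im t)%:C *: ('i%C *: x))).
    by rewrite addrACA scalerDr halfD -scalerA [in RHS]scalerA -scalerDl [in RHS]mulrC.
  apply: avg; apply: seg => //.
    by apply: i_le1; rewrite complexiE ?conjCi // -expr2 sqrCi.
  rewrite -scaleNr; apply: i_le1; rewrite complexiE.
    by rewrite mulrNN -expr2 sqrCi.
  by rewrite rmorphN /= conjCi.
have half_bound (N : nat) : nrm ((2^-1 : R)%:C *: x *+ N) <= 1.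
  pose y := (2^-1 : R)%:C *: x.
  case: N => [|N]; first by rewrite mulr0n nrm0.
  rewrite -[N.+1]bin1 -[X in X *+ _]expr1.
  apply: (@coef_le_sup 1 N.+2 (fun k => y ^+ k *+ 'C(N.+1, k))); last by [].
  move=> t t1.
  have -> : \sum_(c < N.+2) t ^+ c *: (y ^+ c *+ 'C(N.+1, c)) = (1 + t *: y) ^+ N.+1.
    rewrite addrC exprD1n; apply: eq_bigr => c _.
    by rewrite [(t *: y) ^+ c]exprZn scalerMnr.
  rewrite /y scalerA mulrC.
  elim: (N.+1) => [|k IH]; first by rewrite expr0 nrm1.
  rewrite exprS; apply: le_trans (ler_nrmM _ _) _.
  by rewrite mulr_ile1 ?nrm_ge0 ?disc.
apply: (nrm0_eq0 (A := A)); apply/eqP; rewrite eq_le nrm_ge0 andbT leNgt.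
apply/negP => x0.
have := archi_boundP (ltW (divr_gt0 (ltr0n R 2) x0)); set N := Num.bound _.
have := half_bound N; rewrite scalerMnr nrmZ_real ?invr_ge0 // -scaler_nat.
rewrite -(rmorph_nat (real_complex R)) nrmZ_real ?ler0n // mulrC ler_pdivrMr //.
rewrite mul1r ltr_pdivrMr // => le2 lt2.
by have := lt_le_trans lt2 le2; rewrite ltxx.
Qed.

(** Compressing the sum of the range projections by [T j] gives a vanishing sum
  of the elements [a l = T_j^* T_l T_l^* T_j], [l != j], each with
  [|1 - a l| <= 1].  Hence [1 + x] and [1 - x] both lie in the unit ball for a
  multiple [x] of [a i], and extremality of 1 gives [a i = 0]. *)
Lemma isometries_orthogonal (n : nat) (T : 'I_n -> A) :
  (forall i, cstar_isometry (T i)) -> \sum_(i < n) T i * star (T i) = 1 ->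
  forall i j, i != j -> star (T i) * T j = 0.
Proof.
move=> Ti T1 i j ij.
pose a l := star (T j) * (T l * star (T l)) * T j.
have ale (l : 'I_n) : nrm (1 - a l) <= 1.
  have -> : 1 - a l = star (T j) * (1 - T l * star (T l)) * T j.
    by rewrite mulrBr mulr1 mulrBl Ti.
  apply: le_trans (ler_nrmM _ _) _; rewrite (nrm_isometry (Ti j)) mulr1.
  apply: le_trans (ler_nrmM _ _) _; rewrite nrm_star (nrm_isometry (Ti j)) mul1r.
  set p := T l * star (T l).
  have pp : p * p = p by rewrite /p mulrA -(mulrA (T l)) Ti mulr1.
  have ps : star p = p by rewrite /p starM starK.
  have : nrm (1 - p) ^+ 2 = nrm (1 - p).
    by rewrite -cstar_nrm starD starN star1 ps mulrBl mul1r mulrBr mulr1 pp subrr subr0.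
  by have := nrm_ge0 (1 - p); nra.
have suma : \sum_(l | l != j) a l = 0.
  have : \sum_l a l = 1.
    by rewrite /a -mulr_suml -mulr_sumr T1 mulr1 Ti.
  rewrite (bigD1 j) //= {1}/a mulrA Ti mul1r Ti => /eqP.
  by rewrite -subr_eq0 addrAC subrr add0r => /eqP.
rewrite (bigD1 i) //= in suma.
set Q := fun l => (l != j) && (l != i) in suma.
pose M : R := \sum_(l | Q l) 1.
have M0 : 0 <= M by exact: sumr_ge0.
have MC : M%:C *: (1 : A) = \sum_(l | Q l) 1.
  rewrite /M rmorph_sum scaler_suml; apply: eq_bigr => l _.
  by rewrite rmorph1 scale1r.
(* The remaining elements [a l] add up to [- a i]. *)
have Ma : nrm (M%:C *: 1 + a i) <= M.
  have -> : M%:C *: 1 + a i = \sum_(l | Q l) (1 - a l).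
    by rewrite big_split /= sumrN MC; congr (_ + _); apply/eqP; rewrite -addr_eq0 suma.
  by apply: le_trans (ler_nrm_sum _ _ _) _; apply: ler_sum.
have M1 : 0 < M + 1 by rewrite ltr_wpDl.
have aC : star (a i) = a i by rewrite /a !starM !starK !mulrA.
have split1 (y : A) : 1 + (M + 1)^-1%:C *: y = (M + 1)^-1%:C *: (M%:C *: 1 + (1 + y)).
  have -> : M%:C *: 1 + (1 + y) = (M + 1)%:C *: 1 + y.
    by rewrite addrA rmorphD rmorph1 scalerDl scale1r.
  by rewrite scalerDr scalerA -rmorphM /= mulVf ?gt_eqF // rmorph1 scale1r.
have bnd (y : A) : nrm (M%:C *: 1 + (1 + y)) <= M + 1 ->
    nrm (1 + (M + 1)^-1%:C *: y) <= 1.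
  rewrite split1 nrmZ_real ?invr_ge0 ?(ltW M1) // => H.
  by rewrite mulrC ler_pdivrMr // mul1r.
have : (M + 1)^-1%:C *: a i = 0.
  apply: one_extreme_point; first by rewrite starZ aC conj_Creal // complex_real.
    apply: bnd; rewrite addrCA addrC; apply: le_trans (ler_nrmD _ _) _.
    by rewrite nrm1 lerD2r.
  rewrite -scalerN; apply: bnd; apply: le_trans (ler_nrmD _ _) _.
  by rewrite nrmZ_real // nrm1 mulr1 lerD2l.
move/eqP; rewrite scaler_eq0 => /orP[|/eqP ai0].
  by rewrite fmorph_eq0 invr_eq0 gt_eqF.
suff /eqP : nrm (star (T i) * T j) ^+ 2 = 0.
  by rewrite expf_eq0 /= => /eqP /nrm0_eq0.
by rewrite -cstar_nrm starM starK -mulrA (mulrA (T i)) mulrA -/(a i) ai0 nrm0.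
Qed.

End Extremality.

(** * Sums of homogeneous elements of bounded degree *)

Section GradedSpan.
Context (R : realType) (A : cstarAlgType R) (P : int -> A -> Prop).
Hypotheses (P0 : forall d, P d 0)
  (PD : forall d x y, P d x -> P d y -> P d (x + y)).

(** The summand with index [d] has degree [d - D]: the degrees run over the
  integers of absolute value at most [D]. *)
Definition gspan (D : nat) (x : A) := exists x_ : nat -> A,
  (forall d, (d < (2 * D).+1)%N -> P (d%:Z - D%:Z) (x_ d)) /\
  x = \sum_(d < (2 * D).+1) x_ d.

Lemma gspan_hom D d x : (`|d| <= D)%N -> P d x -> gspan D x.
Proof.
move=> dD Px; pose e := `|(d + D%:Z)%R|%N.
have eE : e%:Z - D%:Z = d by lia.
have eD : (e < (2 * D).+1)%N by lia.
exists (fun c => if c == e then x else 0); split.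
  by move=> c _; case: eqP => [->|//]; rewrite eE.
by rewrite -big_mkcond (big_pred1 (Ordinal eD)).
Qed.

Lemma gspan0 D : gspan D 0.
Proof. by exists (fun=> 0); split => //; rewrite big1. Qed.

Lemma gspanD D x y : gspan D x -> gspan D y -> gspan D (x + y).
Proof.
move=> [x_ [Px ->]] [y_ [Py ->]]; exists (fun d => x_ d + y_ d).
by split => [d dD|]; [apply: PD; [exact: Px|exact: Py]|rewrite big_split].
Qed.

Lemma gspan_sum D (I : Type) (s : seq I) (Q : pred I) (F : I -> A) :
  (forall i, Q i -> gspan D (F i)) -> gspan D (\sum_(i <- s | Q i) F i).
Proof. by move=> QF; apply: big_ind QF; [exact: gspan0|exact: gspanD]. Qed.

Lemma gspan_sum_seq D (I : eqType) (s : seq I) (F : I -> A) :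
  (forall i, i \in s -> gspan D (F i)) -> gspan D (\sum_(i <- s) F i).
Proof. by move=> QF; rewrite big_seq; exact: gspan_sum. Qed.

Lemma gspan_le D D' x : (D <= D')%N -> gspan D x -> gspan D' x.
Proof.
move=> DD [x_ [Px ->]]; apply: gspan_sum => d _.
by have dD := ltn_ord d; apply: gspan_hom (Px d dD); lia.
Qed.

Lemma gspanM D D' x y :
  (forall d d' x y, P d x -> P d' y -> P (d + d') (x * y)) ->
  gspan D x -> gspan D' y -> gspan (D + D') (x * y).
Proof.
move=> PM [x_ [Px ->]] [y_ [Py ->]]; rewrite mulr_suml; apply: gspan_sum => d _.
rewrite mulr_sumr; apply: gspan_sum => d' _.
have dD := ltn_ord d; have dD' := ltn_ord d'.
by apply: gspan_hom (PM _ _ _ _ (Px d dD) (Py d' dD')); lia.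
Qed.

Lemma gspan_star D x : (forall d x, P d x -> P (- d) (star x)) ->
  gspan D x -> gspan D (star x).
Proof.
move=> PS [x_ [Px ->]]; rewrite star_sum; apply: gspan_sum => d _.
by have dD := ltn_ord d; apply: gspan_hom (PS _ _ (Px d dD)); lia.
Qed.

End GradedSpan.

(** * Laurent polynomials in a unitary *)

Section Laurent.
Context (R : realType) (A : cstarAlgType R) (z : A).
Hypothesis zu : cstar_unitary z.

Definition zpow (i : int) : A :=
  match i with Posz k => z ^+ k | Negz k => star z ^+ k.+1 end.

Lemma zpowS i : zpow (i + 1) = zpow i * z.
Proof.
have [sz zs] := zu; case: i => [k|[|k]].
- by rewrite -PoszD addn1 /= exprSr.
- by rewrite NegzE addNr /= expr1 sz.
- have -> : (Negz k.+1 + 1 = Negz k)%R by lia.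
  by rewrite /= [in RHS]exprSr -mulrA sz mulr1.
Qed.

Lemma zpowD i j : zpow (i + j) = zpow i * zpow j.
Proof.
have [sz zs] := zu.
elim/int_ind: j => [|k IH|k IH].
- by rewrite addr0 mulr1.
- by rewrite -addn1 PoszD addrA zpowS IH zpowS mulrA.
- have -> : (- (k.+1)%:Z = - k%:Z - 1)%R by lia.
  rewrite addrA; set a := i - k%:Z.
  have /(congr1 (fun x => x * star z)) := zpowS (a - 1).
  rewrite subrK -mulrA zs mulr1 => <-; rewrite IH -mulrA; congr (_ * _).
  have /(congr1 (fun x => x * star z)) := zpowS (- k%:Z - 1).
  by rewrite subrK -mulrA zs mulr1.
Qed.

Lemma zpowNK i : zpow (- i) * zpow i = 1. Proof. by rewrite -zpowD addNr. Qed.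

Lemma star_zpow i : star (zpow i) = zpow (- i).
Proof.
suff nat_case k : star (zpow k%:Z) = zpow (- k%:Z).
  by case: i => k; rewrite // NegzE opprK -nat_case starK.
case: k => [|k]; first by rewrite oppr0 /= expr0 star1.
by rewrite -NegzE /= starX.
Qed.

Lemma zpow_unitary i : cstar_unitary (zpow i).
Proof. by rewrite /cstar_unitary star_zpow -!zpowD addNr addrN. Qed.

Lemma nrm_zpow i : nrm (zpow i) = 1.
Proof. by apply: nrm_isometry; have [] := zpow_unitary i. Qed.

Definition lmono (d : int) (x : A) := exists c : R[i], x = c *: zpow d.
Definition laurent := gspan lmono.

Lemma lmono0 d : lmono d 0. Proof. by exists 0; rewrite scale0r. Qed.
Lemma lmonoD d x y : lmono d x -> lmono d y -> lmono d (x + y).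
Proof. by move=> [a ->] [b ->]; exists (a + b); rewrite scalerDl. Qed.
Lemma lmonoM d d' x y : lmono d x -> lmono d' y -> lmono (d + d') (x * y).
Proof.
by move=> [a ->] [b ->]; exists (a * b); rewrite -scalerAl -scalerAr scalerA zpowD.
Qed.
Lemma lmono_star d x : lmono d x -> lmono (- d) (star x).
Proof. by move=> [a ->]; exists a^*; rewrite starZ star_zpow. Qed.

Lemma laurent_zpow D d : (`|d| <= D)%N -> laurent D (zpow d).
Proof. by move=> dD; apply: gspan_hom dD _; [exact: lmono0|exists 1; rewrite scale1r]. Qed.

Lemma laurentZ D c x : laurent D x -> laurent D (c *: x).
Proof.
move=> [x_ [Px ->]]; rewrite scaler_sumr; apply: gspan_sum => [||d _].
- exact: lmono0.
- exact: lmonoD.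
apply: gspan_hom; first exact: lmono0; last first.
  by have [a ->] := Px d (ltn_ord d); exists (c * a); rewrite scalerA.
by have := ltn_ord d; lia.
Qed.

End Laurent.

(** * The relations, words and matrix entries *)

(** The relations in terms of the two generators [z] and [S = S_1]. *)
Record odometer (R : realType) (m n : nat) (A : cstarAlgType R) (z S : A) :
    Prop := {
  odo_unitary : cstar_unitary z;
  odo_isometry : cstar_isometry S;
  odo_shift : z ^+ n * S = S * z ^+ m;
  odo_sum : \sum_(0 <= i < n) (z ^+ i * S) * star (z ^+ i * S) = 1
}.

Section Words.
Context (R : realType) (m n : nat) (A : cstarAlgType R) (z S : A).
Hypotheses (n_gt1 : (1 < n)%N) (odo : odometer m n z S).

Let zu := odo_unitary odo.
Let SS : star S * S = 1 := odo_isometry odo.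

Local Notation zpow := (zpow z).
Local Notation laurent := (laurent z).

Lemma shifted_isometry i : cstar_isometry (z ^+ i * S).
Proof.
rewrite /cstar_isometry starM mulrA -(mulrA (star S)).
by have [-> _] := zpow_unitary zu i; rewrite mulr1 SS.
Qed.

Lemma zpow_shift (q : int) : zpow (n%:Z * q) * S = S * zpow (m%:Z * q).
Proof.
have nat_case (j : nat) : zpow (n%:Z * j) * S = S * zpow (m%:Z * j).
  elim: j => [|j IH]; first by rewrite !mulr0 mul1r mulr1.
  rewrite -addn1 PoszD !mulrDr !mulr1 !(zpowD zu) -mulrA (odo_shift odo) mulrA IH.
  by rewrite mulrA.
case: q => [j|j]; first exact: nat_case.
rewrite NegzE !mulrN.
apply: etrans (_ : zpow (- (n%:Z * j.+1)) *
  (zpow (n%:Z * j.+1) * S * zpow (- (m%:Z * j.+1))) = _).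
  by rewrite nat_case -!mulrA -(zpowD zu) subrr mulr1.
by rewrite !mulrA (zpowNK zu) mul1r.
Qed.

(** For [r] not divisible by [n], the isometries [S] and [z^r S] have orthogonal
  ranges; otherwise [z^r] moves past [S]. *)
Lemma compress_zpow (r : int) :
  star S * zpow r * S = if (n%:Z %| r)%Z then zpow (m%:Z * (r %/ n%:Z)%Z) else 0.
Proof.
have n0 : n%:Z != 0 by case: (n) n_gt1.
have re := divz_eq r n%:Z.
rewrite {1}re addrC mulrC (zpowD zu) mulrA -mulrA [_ * S]zpow_shift mulrA.
case: ifP => [/dvdz_mod0P ->|]; first by rewrite mulr1 SS mul1r.
have [j rj] : exists j : nat, (r %% n%:Z)%Z = j.
  by exists `|(r %% n%:Z)%Z|%N; rewrite gez0_abs // modz_ge0.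
have jn : (j < n)%N by rewrite -ltz_nat -rj ltz_pmod //; case: (n) n_gt1.
move=> /negbT rn; have j0 : (0 < j)%N.
  by rewrite lt0n; apply: contra rn => /eqP j0; apply/dvdz_mod0P; rewrite rj j0.
have n_gt0 := ltnW n_gt1.
rewrite rj; pose T (i : 'I_n) := z ^+ i * S.
have -> : star S * zpow j%:Z * S = star (T (Ordinal n_gt0)) * T (Ordinal jn).
  by rewrite /T /= expr0 mul1r mulrA.
rewrite isometries_orthogonal ?mul0r //.
- by move=> i; exact: shifted_isometry.
- by rewrite /T -(odo_sum odo) big_mkord.
- by rewrite -val_eqE /= neq_ltn j0.
Qed.

(** Each compression by [S] replaces a factor [n] of the exponent by a factor
  [m], which is prime to [n], so [a] compressions need divisibility by [n^a]. *)
Lemma compress_zpow_iter a (r : int) : coprime m n ->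
  ~~ ((n ^ a)%N%:Z %| r)%Z -> star (S ^+ a) * zpow r * S ^+ a = 0.
Proof.
move=> mn; elim: a r => [|a IH] r; first by rewrite expn0 dvd1z.
have -> : star (S ^+ a.+1) * zpow r * S ^+ a.+1 =
    star (S ^+ a) * (star S * zpow r * S) * S ^+ a.
  by rewrite exprS starM !mulrA.
rewrite compress_zpow; case: ifP => [/dvdzP [q ->]|_ _]; last by rewrite mulr0 mul0r.
have n0 : n%:Z != 0 by case: (n) n_gt1.
rewrite mulzK // expnSr PoszM dvdz_mul2r // => naq.
apply: IH; rewrite Gauss_dvdzr // coprimezE /= coprime_sym.
exact: coprimeXr.
Qed.

Fixpoint words l : seq A :=
  if l is l'.+1
  then [seq v * (z ^+ i * S) | v <- words l', i <- index_iota 0 n]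
  else [:: 1].

Lemma words_isometry l v : v \in words l -> cstar_isometry v.
Proof.
elim: l v => [|l IH] v /=.
  by rewrite inE => /eqP ->; rewrite /cstar_isometry star1 mulr1.
case/allpairsP => [[w i] /= [wl _ ->]]; rewrite /cstar_isometry starM.
by rewrite -mulrA (mulrA (star w)) IH // mul1r shifted_isometry.
Qed.

Lemma words_sum l : \sum_(v <- words l) v * star v = 1.
Proof.
elim: l => [|l IH] /=; first by rewrite big_seq1 star1 mulr1.
rewrite big_allpairs_dep -{}[RHS]IH; apply: eq_bigr => v _.
rewrite -[X in _ = X * _]mulr1 -(odo_sum odo) mulr_sumr mulr_suml.
by apply: eq_bigr => i _; rewrite !starM !mulrA.
Qed.

(** The matrix of [x] with respect to words of lengths [l] and [l'] consists of
  Laurent polynomials of degree at most [D]. *)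
Definition entries l l' D (x : A) := forall v w, v \in words l -> w \in words l' ->
  laurent D (star v * x * w).

Lemma entries_decomp l l' x :
  x = \sum_(v <- words l) \sum_(w <- words l') v * (star v * x * w) * star w.
Proof.
rewrite -{1}[x]mul1r -(words_sum l) mulr_suml; apply: eq_bigr => v _.
rewrite -{1}[x]mulr1 -(words_sum l') !mulr_sumr; apply: eq_bigr => w _.
by rewrite !mulrA.
Qed.

Lemma entriesM l l' l'' D D' x y :
  entries l l' D x -> entries l' l'' D' y -> entries l l'' (D + D') (x * y).
Proof.
move=> Hx Hy v w vl wl.
have -> : star v * (x * y) * w =
    \sum_(u <- words l') (star v * x * u) * (star u * y * w).
  rewrite -{1}[x]mulr1 -(words_sum l') mulr_sumr !mulr_suml mulr_sumr mulr_suml.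
  by apply: eq_bigr => u _; rewrite !mulrA.
apply: gspan_sum_seq => [||u ul]; [exact: lmono0|exact: lmonoD|].
apply: gspanM; [exact: lmono0|exact: lmonoD|exact: lmonoM| |].
  exact: Hx.
exact: Hy.
Qed.

Lemma entries_star l l' D x : entries l l' D x -> entries l' l D (star x).
Proof.
move=> Hx v w vl wl.
have -> : star v * star x * w = star (star w * x * v).
  by rewrite !starM starK mulrA.
by apply: gspan_star (Hx _ _ wl vl); [exact: lmono0|exact: lmonoD|exact: lmono_star].
Qed.

Lemma entries_le l l' D D' x : (D <= D')%N ->
  entries l l' D x -> entries l l' D' x.
Proof.
move=> DD Hx v w vl wl.
by apply: gspan_le DD (Hx _ _ vl wl); [exact: lmono0|exact: lmonoD].
Qed.

Lemma entriesD l l' D x y :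
  entries l l' D x -> entries l l' D y -> entries l l' D (x + y).
Proof.
move=> Hx Hy v w vl wl; rewrite mulrDr mulrDl.
by apply: gspanD (Hx _ _ vl wl) (Hy _ _ vl wl); exact: lmonoD.
Qed.

Lemma entries0 l l' D : entries l l' D 0.
Proof. by move=> v w _ _; rewrite mulr0 mul0r; apply: gspan0; exact: lmono0. Qed.

Lemma laurent_compress D x : laurent D x -> laurent (m * D) (star S * x * S).
Proof.
move=> [x_ [Px ->]]; rewrite mulr_sumr mulr_suml.
apply: gspan_sum => [||d _]; [exact: lmono0|exact: lmonoD|].
have dD := ltn_ord d; have [c ->] := Px d dD.
rewrite -scalerAr -scalerAl; apply: laurentZ.
rewrite compress_zpow; case: ifP => [/dvdzP [q qE]|_]; last by apply: gspan0; exact: lmono0.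
have n0 : n%:Z != 0 by case: (n) n_gt1.
rewrite qE mulzK //; apply: laurent_zpow; rewrite abszM leq_mul2l; apply/orP; right.
have : (`|(q * n%:Z)%R| <= D)%N by rewrite -qE; lia.
by rewrite abszM; apply: leq_trans; rewrite leq_pmulr // ltnW.
Qed.

(** The entries at the next level are compressions by [S] of shifted entries, and
  compression by [S] sends [z^r] to a power of [z] or to 0. *)
Lemma entries_raise1 l l' D x :
  entries l l' D x -> entries l.+1 l'.+1 (m * (n + D + n)) x.
Proof.
move=> Hx _ _ /allpairsP[[v i] /= [vl il ->]] /allpairsP[[w j] /= [wl jl ->]].
move: il jl; rewrite !mem_index_iota /= => il jl.
have -> : star (v * (z ^+ i * S)) * x * (w * (z ^+ j * S)) =
    star S * (zpow (- i%:Z) * (star v * x * w) * zpow j) * S.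
  by rewrite !starM -star_zpow !mulrA.
apply: laurent_compress.
by apply: gspanM; [exact: lmono0|exact: lmonoD|exact: lmonoM| |apply: laurent_zpow; lia];
   apply: gspanM (Hx _ _ vl wl); [exact: lmono0|exact: lmonoD|exact: lmonoM|
   apply: laurent_zpow; lia].
Qed.

Lemma entries_raise k l l' D x :
  entries l l' D x -> exists D', entries (l + k) (l' + k) D' x.
Proof.
move=> Hx; elim: k => [|k [D' IH]]; first by rewrite !addn0; exists D.
by rewrite !addnS; exists (m * (n + D' + n))%N; exact: entries_raise1.
Qed.

(** Homogeneity of degree [d] for the gauge action, restricted to elements with
  Laurent polynomial entries.  The level is not determined by [x]; raising it
  makes two homogeneous elements comparable. *)
Definition homog (d : int) (x : A) :=
  exists l l' D, l%:Z - l'%:Z = d /\ entries l l' D x.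

Lemma homog0 d : homog d 0.
Proof.
clear n_gt1; case: d => k; first by exists k, 0%N, 0%N; split; [lia|exact: entries0].
by exists 0%N, k.+1, 0%N; split; [lia|exact: entries0].
Qed.

Lemma homogD d x y : homog d x -> homog d y -> homog d (x + y).
Proof.
move=> [l1 [l1' [D1 [e1 H1]]]] [l2 [l2' [D2 [e2 H2]]]].
have [D1' {}H1] := entries_raise l2 H1; have [D2' {}H2] := entries_raise l1 H2.
have e : (l2' + l1)%N = (l1' + l2)%N by lia.
exists (l1 + l2)%N, (l1' + l2)%N, (D1' + D2')%N; split; first by lia.
rewrite e addnC in H2.
by apply: entriesD; [apply: entries_le H1|apply: entries_le H2]; lia.
Qed.

Lemma homogM d d' x y : homog d x -> homog d' y -> homog (d + d') (x * y).
Proof.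
move=> [l1 [l1' [D1 [e1 H1]]]] [l2 [l2' [D2 [e2 H2]]]].
have [D1' {}H1] := entries_raise l2 H1; have [D2' {}H2] := entries_raise l1' H2.
exists (l1 + l2)%N, (l2' + l1')%N, (D1' + D2')%N; split; first by lia.
by rewrite [(l2 + _)%N]addnC in H2; exact: entriesM H1 H2.
Qed.

Lemma homog_star d x : homog d x -> homog (- d) (star x).
Proof.
clear n_gt1; move=> [l [l' [D [e H]]]]; exists l', l, D; split; first by lia.
exact: entries_star.
Qed.

Lemma homogZ d c x : homog d x -> homog d (c *: x).
Proof.
move=> [l [l' [D [e H]]]]; exists l, l', D; split=> // v w vl wl.
by rewrite -scalerAr -scalerAl; exact/laurentZ/H.
Qed.

Lemma homog_z : homog 0 z.
Proof.
exists 0%N, 0%N, 1%N; split=> // v w; rewrite !inE => /eqP -> /eqP ->.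
by rewrite star1 mul1r mulr1; exact: (@laurent_zpow _ _ z 1 1).
Qed.

Lemma homog_S : homog 1 S.
Proof.
exists 1%N, 0%N, (m * n)%N; split=> // _ w /allpairsP[[v i] /= [vl il ->]].
move: il vl; rewrite mem_index_iota !inE /= => il /eqP -> /eqP ->.
have -> : star (1 * (z ^+ i * S)) * S * 1 = star S * zpow (- i%:Z) * S.
  by rewrite mul1r mulr1 starM -star_zpow.
by apply/laurent_compress/laurent_zpow; lia.
Qed.

Definition graded D := gspan homog D.

End Words.

(** * Density and closed ranges *)

Section Closures.
Context (R : realType) (A : cstarAlgType R).

Lemma closure_subalgebra (D0 : set A) : D0 0 ->
  (forall (a : R[i]) x y, D0 x -> D0 y -> D0 (a *: x + y)) ->
  (forall x y, D0 x -> D0 y -> D0 (x * y)) ->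
  (forall x, D0 x -> D0 (star x)) ->
  cstar_subalgebra
    [set x : A | forall e, 0 < e -> exists2 y, D0 y & nrm (x - y) < e].
Proof.
move=> D00 DP DM DS; split.
- by move=> e e0; exists 0; rewrite // subr0 nrm0.
- move=> a x y Hx Hy e e0.
  pose K := complex.Re `|a| + 1.
  have Ka : 0 <= complex.Re `|a| by rewrite -lecR RRe_real ?normr_real ?normr_ge0.
  have K0 : 0 < K by rewrite ltr_wpDl.
  have e1 : 0 < e / K by exact: divr_gt0.
  have [x1 Dx1 xx1] := Hx _ e1; have [y1 Dy1 yy1] := Hy _ e1.
  exists (a *: x1 + y1); first exact: DP.
  rewrite opprD addrACA -scalerBr; apply: le_lt_trans (ler_nrmD _ _) _.
  have eK : (e / K) * K = e by rewrite divfK // gt_eqF.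
  by rewrite nrmZ -eK /K; move: xx1 yy1; rewrite -/K; move: (e / K) => e'; rewrite /K; nra.
- move=> x y Hx Hy e e0.
  pose K := nrm x + nrm y + 1.
  have x0 := nrm_ge0 x; have y0 := nrm_ge0 y.
  have K0 : 0 < K by rewrite ltr_wpDl // addr_ge0.
  have eK0 : 0 < e + K by rewrite addr_gt0.
  have e1 : 0 < e / (e + K) by exact: divr_gt0.
  have [x1 Dx1 xx1] := Hx _ e1; have [y1 Dy1 yy1] := Hy _ e1.
  exists (x1 * y1); first exact: DM.
  have -> : x * y - x1 * y1 = (x - x1) * y1 + x * (y - y1).
    by rewrite mulrBl mulrBr [RHS]addrC addrA subrK.
  apply: le_lt_trans (ler_nrmD _ _) _.
  have := ler_nrmM (x - x1) y1; have := ler_nrmM x (y - y1).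
  have : nrm y1 <= nrm y + nrm (y - y1).
    by rewrite nrmB -{1}(subrK y y1) addrC ler_nrmD.
  have : e / (e + K) <= 1 by rewrite ler_pdivrMr // mul1r lerDl ltW.
  have : e / (e + K) * K < e.
    by rewrite mulrAC ltr_pdivrMr // (mulrDr e e) ltrDr mulr_gt0.
  move: xx1 yy1 (nrm_ge0 (x - x1)) (nrm_ge0 (y - y1)) (nrm_ge0 y1) e1.
  move: (e / (e + K)) => e'; rewrite /K.
  move: (nrm (x * (y - y1))) (nrm ((x - x1) * y1)) => u1 u2.
  move: (nrm (x - x1)) (nrm (y - y1)) (nrm y1) => v1 v2 v3.
  move: (nrm x) (nrm y) x0 y0 => a b.
  move=> a0 b0 v1e v2e v10 v20 v30 e'0 eab e'1 v3b u1b u2b.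
  have : v1 * v3 <= e' * (b + 1).
    by apply: ler_pM => //; [exact: ltW|lra].
  have : a * v2 <= a * e' by apply: ler_wpM2l => //; exact: ltW.
  nra.
- move=> x Hx e e0; have [y Dy xy] := Hx _ e0.
  by exists (star y); [exact: DS|rewrite -starN -starD nrm_star].
- apply: closed_nrm => x Hx e e0.
  have e2 : 0 < e / 2 by exact: divr_gt0.
  have [y Dy xy] := Hx _ e2; have [w Dw yw] := Dy _ e2.
  exists w => //; rewrite -(subrKA y); apply: le_lt_trans (ler_nrmD _ _) _.
  by rewrite [e]splitr ltrD.
Qed.

(** The range is closed because [f] is isometric: approximate preimages of a limit
  point form a Cauchy sequence. *)
Lemma range_subalgebra (B : cstarAlgType R) (f : {lrmorphism A -> B}) :
  (forall x, f (star x) = star (f x)) -> (forall x, nrm (f x) = nrm x) ->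
  cstar_subalgebra (range f).
Proof.
move=> fstar fnrm; split.
- by exists 0; rewrite ?rmorph0.
- by move=> a _ _ [x _ <-] [y _ <-]; exists (a *: x + y); rewrite // linearP.
- by move=> _ _ [x _ <-] [y _ <-]; exists (x * y); rewrite // rmorphM.
- by move=> _ [x _ <-]; exists (star x).
apply: closed_nrm => y Hy.
have inv_gt0 (p : nat) : 0 < (p.+1%:R : R)^-1 by rewrite invr_gt0.
have [u Hu] : {u : nat -> A & forall p, nrm (y - f (u p)) < p.+1%:R^-1}.
  apply: (@choice _ _ (fun p x => nrm (y - f x) < p.+1%:R^-1)) => p.
  by have [_ [x _ <-] xy] := Hy _ (inv_gt0 p); exists x.
have small e : 0 < e -> exists N : nat, forall p, (N <= p)%N -> nrm (y - f (u p)) < e.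
  move=> e0; exists (Num.bound e^-1) => p Np; apply: lt_trans (Hu p) _.
  rewrite -[e]invrK ltf_pV2 ?posrE ?invr_gt0 //.
  apply: lt_le_trans (archi_boundP _) _; first by rewrite invr_ge0 ltW.
  by rewrite ler_nat ltnW.
have [l ul] : exists l, nrm_lim u l.
  apply: nrm_complete => e e0; have [N HN] := small _ (divr_gt0 e0 (ltr0Sn _ 1)).
  exists N => p q Np Nq; rewrite -fnrm rmorphB -(subrKA y).
  apply: le_lt_trans (ler_nrmD _ _) _; rewrite nrmB [e]splitr.
  by rewrite ltrD ?HN.
exists l => //; apply: (@nrm_eps_eq _ _ _ _ 2) => e e0.
have [N HN] := small _ e0; have [M HM] := ul _ e0.
rewrite -(subrKA (f (u (maxn N M)))); apply: le_trans (ler_nrmD _ _) _.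
rewrite -rmorphB fnrm nrmB [nrm (_ - y)]nrmB.
by have := HN _ (leq_maxl N M); have := HM _ (leq_maxr N M); lra.
Qed.

End Closures.

(** * Homomorphisms that agree up to a gauge factor *)

Section Comparison.
Context (R : realType) (m n : nat) (A B : cstarAlgType R) (z S : A).
Hypotheses (odo : odometer m n z S).

Lemma hom_zpow (g : {lrmorphism A -> B}) : (forall x, g (star x) = star (g x)) ->
  forall i, g (zpow z i) = zpow (g z) i.
Proof. by move=> gstar [k|k]; rewrite /= rmorphXn //= gstar. Qed.

Lemma zpow_pow (k : nat) (i : int) : zpow (z ^+ k) i = zpow z (k%:Z * i).
Proof.
case: i => j; first by rewrite /= -exprM.
by rewrite NegzE mulrN -!star_zpow -PoszM /= -exprM.
Qed.

Context (g h : {lrmorphism A -> B}) (t : R[i]).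
Hypotheses (gstar : forall x, g (star x) = star (g x))
  (hstar : forall x, h (star x) = star (h x))
  (gz : g z = h z) (gS : g S = t *: h S).

Lemma compare_words l v : v \in words n z S l -> g v = t ^+ l *: h v.
Proof.
elim: l v => [|l IH] v /=.
  by rewrite inE => /eqP ->; rewrite !rmorph1 scale1r.
case/allpairsP => [[w i] /= [wl _ ->]]; rewrite !rmorphM !rmorphXn /= IH // gz gS.
by rewrite -!scalerAr -scalerAl scalerA -exprS.
Qed.

Lemma compare_laurent D p : laurent z D p -> g p = h p.
Proof.
move=> [p_ [Pp ->]]; rewrite !rmorph_sum; apply: eq_bigr => d _.
have [c ->] := Pp d (ltn_ord d).
by rewrite /= !linearZ /= !hom_zpow // gz.
Qed.

(** On matrix entries [g] and [h] agree, and each word contributes one factor [t]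
  per letter. *)
Lemma compare_entries l l' D x : entries n z S l l' D x ->
  g x = (t ^+ l * t^* ^+ l') *: h x.
Proof.
move=> Hx; rewrite {1}(entries_decomp odo l l' x) {2}(entries_decomp odo l l' x).
rewrite !rmorph_sum scaler_sumr big_seq [RHS]big_seq; apply: eq_bigr => v vl.
rewrite !rmorph_sum scaler_sumr big_seq [RHS]big_seq; apply: eq_bigr => w wl.
rewrite /= (rmorphM g) (rmorphM g v) (rmorphM h) (rmorphM h v) /= gstar hstar.
rewrite (compare_laurent (Hx _ _ vl wl)).
rewrite (compare_words vl) (compare_words wl) starZ rmorphXn.
by rewrite -!scalerAl -!scalerAr scalerA.
Qed.

End Comparison.

(** * The endomorphism raising the unitary to a power is isometric *)

Section Isometric.
Context (R : realType) (m n k : nat) (A : cstarAlgType R) (z S : A).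
Hypotheses (n_gt1 : (1 < n)%N) (mn : coprime m n) (odo : odometer m n z S).
Hypothesis (k_gt0 : (0 < k)%N).
Context (f : {lrmorphism A -> A}).
Hypotheses (fstar : forall x, f (star x) = star (f x))
  (fz : f z = z ^+ k) (fS : f S = S).

Let zu := odo_unitary odo.

Lemma isometryX a : cstar_isometry (S ^+ a).
Proof.
elim: a => [|a IH]; first by rewrite /cstar_isometry star1 mulr1.
rewrite /cstar_isometry exprS starM -mulrA (mulrA (star S)).
by rewrite (odo_isometry odo) mul1r.
Qed.

(** The coefficient of degree [d] of [p] is recovered as
  [S^{*a} z^(- k d) (f p) S^a], where [n^a] exceeds all differences of exponents
  occurring in [f p]. *)
Lemma laurent_bound D p : laurent z D p -> nrm p <= (2 * D).+1%:R * nrm (f p).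
Proof.
move=> [p_ [Pp pE]].
have term_bound (d : 'I_(2 * D).+1) : nrm (p_ d) <= nrm (f p).
  (* [n^a > a], and distinct exponents in [f p] differ by at most [2 k D]. *)
  pose a := (2 * k * D)%N; have aK : (2 * k * D < n ^ a)%N by exact: ltn_expl.
  have [c cE] := Pp d (ltn_ord d).
  have : c *: 1 = star (S ^+ a) * zpow z (- (k%:Z * (d%:Z - D%:Z))) * f p * S ^+ a.
    rewrite pE rmorph_sum mulr_sumr mulr_suml (bigD1 d) //= big1 ?addr0.
      rewrite /= cE linearZ /= hom_zpow // fz zpow_pow // -!scalerAr -scalerAl.
      by rewrite -(mulrA (star _)) zpowNK // mulr1 isometryX.
    move=> e ed; have [c' ->] := Pp e (ltn_ord e).
    rewrite /= linearZ /= hom_zpow // fz zpow_pow // -scalerAr -scalerAl.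
    rewrite -(mulrA (star _)) -(zpowD zu) (compress_zpow_iter n_gt1 odo) ?scaler0 //.
    set q := _ + _; have -> : q = k%:Z * (e%:Z - d%:Z) by rewrite /q; ring.
    have eD := ltn_ord e; have dD := ltn_ord d.
    apply: contra ed => qd; rewrite -val_eqE /=; apply: contraT => ed.
    have : (n ^ a <= `|(k%:Z * (e%:Z - d%:Z))%R|)%N.
      apply: dvdn_leq => //; rewrite abszM muln_gt0 k_gt0 /=; lia.
    rewrite abszM /= leqNgt; suff -> : (k * `|(e%:Z - d%:Z)%R| < n ^ a)%N by [].
    apply: leq_ltn_trans aK; rewrite mulnAC mulnC leq_mul2r; apply/orP; right; lia.
  have Sa := nrm_isometry (isometryX a).
  move=> /(congr1 (@nrm R A)); rewrite cE [nrm (c *: zpow _ _)]nrmZ nrm_zpow // mulr1.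
  rewrite nrmZ nrm1 mulr1 => ->.
  apply: le_trans (ler_nrmM _ _) _; rewrite Sa mulr1.
  apply: le_trans (ler_nrmM _ _) _; rewrite -[X in _ <= X]mul1r ler_wpM2r ?nrm_ge0 //.
  by apply: le_trans (ler_nrmM _ _) _; rewrite nrm_star Sa nrm_zpow // mulr1.
rewrite {1}pE; apply: le_trans (ler_nrm_sum _ _ _) _.
apply: le_trans (ler_sum _ (fun d _ => term_bound d)) _.
by rewrite sumr_const card_ord mulr_natl.
Qed.

(** The number of coefficients is linear in [D] for fixed levels; this is what the
  passage to powers needs. *)
Lemma entries_bound l l' D x : entries n z S l l' D x ->
  nrm x <= (size (words n z S l))%:R * (size (words n z S l'))%:R *
           (2 * D).+1%:R * nrm (f x).
Proof.
move=> Hx; rewrite {1}(entries_decomp odo l l' x).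
have fw i v : v \in words n z S i -> nrm (f v) <= 1.
  by move=> /(words_isometry odo)/nrm_isometry <-; exact: hom_contractive.
apply: le_trans (ler_nrm_sum _ _ _) _.
apply: (@le_trans _ _ (\sum_(v <- words n z S l) \sum_(w <- words n z S l')
    (2 * D).+1%:R * nrm (f x))).
  rewrite big_seq [leRHS]big_seq; apply: ler_sum => v vl.
  apply: le_trans (ler_nrm_sum _ _ _) _.
  rewrite big_seq [leRHS]big_seq; apply: ler_sum => w wl.
  have vn := nrm_isometry (words_isometry odo vl).
  have wn := nrm_isometry (words_isometry odo wl).
  apply: le_trans (ler_nrmM _ _) _; rewrite nrm_star wn mulr1.
  apply: le_trans (ler_nrmM _ _) _; rewrite vn mul1r.
  apply: le_trans (laurent_bound (Hx _ _ vl wl)) _.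
  rewrite ler_pM2l // !rmorphM /= fstar.
  apply: le_trans (ler_nrmM _ _) _; rewrite -[leRHS]mulr1.
  apply: ler_pM; rewrite ?nrm_ge0 ?(fw _ _ wl) //.
  apply: le_trans (ler_nrmM _ _) _; rewrite -[leRHS]mul1r nrm_star.
  by apply: ler_pM; rewrite ?nrm_ge0 ?(fw _ _ vl).
have sumc (s : seq A) (c : R) : \sum_(v <- s) c = (size s)%:R * c.
  by rewrite big_const_seq count_predT iter_addr_0 mulr_natl.
by rewrite !sumc !mulrA.
Qed.

Lemma entries_sqpow l D x j :
  entries n z S l l D x -> entries n z S l l (D * 2 ^ j) (x ^+ (2 ^ j)).
Proof.
move=> Hx; elim: j => [|j IH]; first by rewrite expn0 muln1.
rewrite expnSr exprM expr2 mulnA muln2 -addnn.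
exact: (entriesM odo IH IH).
Qed.

(** The bound for fixed levels applies to the powers of [x^* x], which has the same
  row and column level. *)
Lemma homog_expanding d x : homog n z S d x -> nrm x <= nrm (f x).
Proof.
move=> [l [l' [D [_ Hx]]]].
have core y D' : entries n z S l' l' D' y -> nrm y <= nrm (f y).
  move=> Hy; pose C : R := (size (words n z S l'))%:R * (size (words n z S l'))%:R.
  have C0 : 0 <= C by rewrite mulr_ge0.
  have Hyy : entries n z S l' l' (D' + D') (star y * y).
    exact: (entriesM odo (entries_star Hy) Hy).
  apply: (hom_expanding fstar C0 (E := (2 * (D' + D'))%:R)) => // j.
  apply: le_trans (entries_bound (entries_sqpow j Hyy)) _.
  by rewrite -[in leRHS]natrM mulnA nat1r.
rewrite -(@ler_pXn2r _ 2) ?nnegrE ?nrm_ge0 // -!cstar_nrm -fstar -rmorphM.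
exact/core/(entriesM odo (entries_star Hx) Hx).
Qed.

Hypothesis gauge : forall t : R[i], `|t| = 1 ->
  exists g : {lrmorphism A -> A},
    [/\ forall x, g (star x) = star (g x), g z = z & g S = t *: S].

Lemma gauge_homog (t : R[i]) (g : {lrmorphism A -> A}) (D d : nat) x : `|t| = 1 ->
  (forall x, g (star x) = star (g x)) -> g z = z -> g S = t *: S ->
  homog n z S (d%:Z - D%:Z) x -> t ^+ d *: f x = t ^+ D *: g (f x).
Proof.
move=> t1 gstar gz gS [l [l' [D' [ll Hx]]]].
have tt : t * t^* = 1 by rewrite -normCK t1 expr1n.
have gfstar y : (g \o f) (star y) = star ((g \o f) y) by rewrite /= fstar gstar.
have := compare_entries odo (g := g \o f) gfstar fstar _ _ Hx.
move=> /(_ t); rewrite /= fz fS rmorphXn /= gz => /(_ erefl gS) ->.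
rewrite scalerA mulrA -exprD; congr (_ *: _).
have -> : (D + l = d + l')%N by lia.
by rewrite exprD -mulrA -exprMn tt expr1n mulr1.
Qed.

(** The gauge automorphisms isolate the homogeneous components of [f x]. *)
Lemma graded_bound D x : graded n z S D x ->
  nrm x <= (2 * D).+1%:R * nrm (f x).
Proof.
move=> [x_ [Px xE]].
have term_bound d : (d < (2 * D).+1)%N -> nrm (f (x_ d)) <= nrm (f x).
  apply: (coef_le_sup (v := f \o x_)) => t t1 /=.
  have [g [gstar gz gS]] := gauge t1.
  have -> : \sum_(c < (2 * D).+1) t ^+ c *: f (x_ c) = t ^+ D *: g (f x).
    rewrite xE !rmorph_sum scaler_sumr; apply: eq_bigr => c _.
    exact: (gauge_homog t1 gstar gz gS (Px c (ltn_ord c))).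
  by rewrite nrmZ_unit ?normrX ?t1 ?expr1n //; exact: hom_contractive.
rewrite {1}xE; apply: le_trans (ler_nrm_sum _ _ _) _.
apply: (@le_trans _ _ (\sum_(d < (2 * D).+1) nrm (f x))).
  apply: ler_sum => d _; apply: le_trans (homog_expanding (Px d (ltn_ord d))) _.
  exact: term_bound.
by rewrite sumr_const card_ord mulr_natl.
Qed.

Lemma graded_expanding D x : graded n z S D x -> nrm x <= nrm (f x).
Proof.
move=> Hx; have C1 : 0 <= 1 :> R by [].
apply: (hom_expanding fstar C1 (E := (2 * (D + D))%:R)) => // j.
have Hj : graded n z S ((D + D) * 2 ^ j) ((star x * x) ^+ (2 ^ j)).
  have gM D1 D2 y1 y2 : graded n z S D1 y1 -> graded n z S D2 y2 ->
      graded n z S (D1 + D2) (y1 * y2).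
    by apply: gspanM; [exact: homog0|exact: (homogD n_gt1 odo)|exact: (homogM n_gt1 odo)].
  elim: j => [|j IH]; last by rewrite expnSr exprM expr2 mulnA muln2 -addnn; exact: gM.
  rewrite expn0 muln1 expr1; apply: gM => //.
  by apply: gspan_star Hx; [exact: homog0|exact: (homogD n_gt1 odo)|exact: homog_star].
apply: le_trans (graded_bound Hj) _.
by rewrite mul1r -natrM mulnA nat1r.
Qed.

Hypothesis gen : cstar_generated [set z; S] = [set: A].

(** The finite sums of homogeneous elements form a *-algebra containing the
  generators, hence are dense, and both sides are continuous. *)
Lemma hom_isometric x : nrm (f x) = nrm x.
Proof.
apply/eqP; rewrite eq_le hom_contractive //=.
have lift D D' y : graded n z S D y -> graded n z S (D + D') y.
  by apply: gspan_le; [exact: homog0|exact: (homogD n_gt1 odo)|exact: leq_addr].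
have := @closure_subalgebra R A [set y | exists D, graded n z S D y].
case=> [||||].
- by exists 0%N; apply: gspan0; exact: homog0.
- move=> a y1 y2 [D1 H1] [D2 H2]; exists (D1 + D2)%N; apply: gspanD.
  + exact: (homogD n_gt1 odo).
  + apply: lift; move: H1 => [y_ [Py ->]]; rewrite scaler_sumr.
    exists (fun d => a *: y_ d); split=> // d dD.
    exact/homogZ/Py.
  + by rewrite addnC; exact: lift.
- move=> y1 y2 [D1 H1] [D2 H2]; exists (D1 + D2)%N.
  apply: gspanM H1 H2; [exact: homog0|exact: (homogD n_gt1 odo)|].
  exact: (homogM n_gt1 odo).
- move=> y [D H]; exists D.
  by apply: gspan_star H; [exact: homog0|exact: (homogD n_gt1 odo)|exact: homog_star].
set K := [set y | _]; move=> ? ? ? ? ?.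
have KK : cstar_subalgebra K by split.
have : [set: A] `<=` K.
  rewrite -gen; apply: smallest_sub => // y [->|->] e e0.
    exists z; last by rewrite subrr nrm0.
    exists 0%N; have z0 := homog_z n z S.
    exact: (@gspan_hom _ _ _ (@homog0 _ n _ z S) 0%N 0 z (leqnn _) z0).
  exists S; last by rewrite subrr nrm0.
  exists 1%N; have S1 := homog_S n_gt1 odo.
  exact: (@gspan_hom _ _ _ (@homog0 _ n _ z S) 1%N 1 S (leqnn _) S1).
move=> /(_ x I) Kx; apply/ler_addgt0Pr => e e0.
have [y [D Hy] xy] := Kx _ (divr_gt0 e0 (ltr0Sn _ 1)).
have := graded_expanding Hy; have := hom_contractive fstar (y - x).
have := ler_nrmD (x - y) y; rewrite subrK.
have := ler_nrmD (f (y - x)) (f x); rewrite -rmorphD subrK.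
by rewrite [nrm (y - x)]nrmB; lra.
Qed.

End Isometric.

(** * Generated subalgebras and periodic sums *)

Section Generated.
Context (R : realType) (A : cstarAlgType R).

Lemma generated_subalgebra (G : set A) : cstar_subalgebra (cstar_generated G).
Proof.
split.
- by move=> D [/csub0].
- by move=> a x y Hx Hy D DG; apply: (csubP DG.1); [exact: Hx|exact: Hy].
- by move=> x y Hx Hy D DG; apply: (csubM DG.1); [exact: Hx|exact: Hy].
- by move=> x Hx D DG; apply: (csub_star DG.1); exact: Hx.
rewrite /cstar_generated /smallest; apply: closed_bigI => D [DG _].
exact: csub_closed DG.
Qed.

Lemma generated_sub (G : set A) (D : set A) :
  cstar_subalgebra D -> G `<=` D -> cstar_generated G `<=` D.
Proof. exact: smallest_sub. Qed.

Lemma preimage_subalgebra (B : cstarAlgType R) (f : {lrmorphism A -> B})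
    (D : set B) : (forall x, f (star x) = star (f x)) ->
  (forall x, nrm (f x) <= nrm x) -> cstar_subalgebra D ->
  cstar_subalgebra [set x | D (f x)].
Proof.
move=> fs fle HD; split.
- by rewrite /= rmorph0; exact: csub0 HD.
- by move=> a x y /= Dx Dy; rewrite linearP; exact: (csubP HD a Dx Dy).
- by move=> x y /= Dx Dy; rewrite rmorphM; exact: (csubM HD Dx Dy).
- by move=> x /= Dx; rewrite fs; exact: (csub_star HD Dx).
apply: closed_nrm => x Hx /=; apply: closed_nrm_limit (csub_closed HD) _ => e e0.
have [y Dy xy] := Hx _ e0; exists (f y) => //.
by apply: le_lt_trans xy; rewrite -rmorphB; exact: fle.
Qed.

(** Multiplication by [k] permutes the residues modulo [n]. *)
Lemma sum_periodic (n k : nat) (F : nat -> A) : (0 < n)%N -> coprime k n ->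
  (forall i, F (i + n)%N = F i) ->
  \sum_(0 <= i < n) F (k * i)%N = \sum_(0 <= i < n) F i.
Proof.
move=> n0 kn Fn; have Fmod i : F i = F (i %% n)%N.
  rewrite {1}(divn_eq i n); elim: (i %/ n)%N => [|q IH]; first by rewrite mul0n.
  by rewrite mulSn -addnA addnC Fn.
rewrite !big_mkord.
pose g (i : 'I_n) : 'I_n := Ordinal (ltn_pmod (k * i) n0).
have ginj : injective g.
  move=> i j /(congr1 val) /= /eqP; rewrite -[_ == _]/(k * i == k * j %[mod n]).
  wlog ij : i j / (i <= j)%N => [wl|].
    by case: (leqP i j) => [|/ltnW] H; [exact: wl|rewrite eq_sym => /wl ->].
  rewrite eq_sym eqn_mod_dvd ?leq_mul2l ?ij ?orbT // -mulnBr.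
  rewrite Gauss_dvdr 1?coprime_sym // => dvd; apply/val_inj/eqP => /=.
  rewrite eqn_leq ij /= -subn_eq0; apply: contraT; rewrite -lt0n => ji.
  have := dvdn_leq ji dvd; have := ltn_ord j; lia.
rewrite [RHS](reindex_inj ginj) /=; apply: eq_bigr => i _.
by rewrite -Fmod.
Qed.

End Generated.

(** * Universality and the reduction to exponents prime to n *)

Section Odometer.
Context (R : realType) (m n : nat).

Lemma shift_pow (A : cstarAlgType R) (z S : A) j : odometer m n z S ->
  z ^+ (n * j) * S = S * z ^+ (m * j).
Proof. by move=> odo; have := zpow_shift odo j%:Z. Qed.

(** The range projection of [z^i S] is [n]-periodic in [i], because [z^n S] and [S]
  differ by the unitary [z^m] on the right. *)
Lemma odometer_pow (A : cstarAlgType R) (z S : A) k : (0 < n)%N -> coprime k n ->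
  odometer m n z S -> odometer m n (z ^+ k) S.
Proof.
move=> n0 kn odo; split.
- exact: zpow_unitary (odo_unitary odo) k%:Z.
- exact: odo_isometry odo.
- by rewrite -!exprM mulnC (mulnC k) shift_pow.
rewrite -(odo_sum odo).
rewrite -(@sum_periodic R A n k (fun i => (z ^+ i * S) * star (z ^+ i * S))) //.
  by apply: eq_bigr => i _; rewrite -exprM.
move=> i /=; have -> : z ^+ (i + n) * S = z ^+ i * S * z ^+ m.
  by rewrite exprD -mulrA (odo_shift odo) mulrA.
have [_ zz1] : cstar_unitary (z ^+ m) := zpow_unitary (odo_unitary odo) m%:Z.
by rewrite starM mulrA -(mulrA (z ^+ i * S)) zz1 mulr1.
Qed.

Lemma odometer_gauge (A : cstarAlgType R) (z S : A) (t : R[i]) : `|t| = 1 ->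
  odometer m n z S -> odometer m n z (t *: S).
Proof.
move=> t1 odo; have tt : t * t^* = 1 by rewrite -normCK t1 expr1n.
split.
- exact: odo_unitary odo.
- rewrite /cstar_isometry starZ -scalerAr -scalerAl scalerA tt scale1r.
  exact: odo_isometry odo.
- by rewrite -scalerAr -scalerAl (odo_shift odo).
rewrite -(odo_sum odo); apply: eq_bigr => i _.
by rewrite -scalerAr starZ -scalerAr -scalerAl scalerA mulrC tt scale1r.
Qed.

Lemma Omn_odometer (A : cstarAlgType R) (z : A) (S : 'I_n -> A) (n0 : (0 < n)%N) :
  Omn_relations m z S -> odometer m n z (S (Ordinal n0)) /\
  forall i, S i = z ^+ i * S (Ordinal n0).
Proof.
move=> [zu Si Ss Sl S1].
have SE (i : 'I_n) : S i = z ^+ i * S (Ordinal n0).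
  case: i => i; elim: i => [|i IH] lt_in.
    by rewrite expr0 mul1r; congr S; exact: val_inj.
  by rewrite exprS -mulrA -(IH (ltnW lt_in)); symmetry; exact: Ss.
split=> //; split=> //.
  have lt_n : (n.-1 < n)%N by rewrite ltn_predL.
  rewrite -(Sl (Ordinal n0) (Ordinal lt_n)) //=; last by rewrite prednK.
  by rewrite [S (Ordinal lt_n)]SE /= mulrA -exprS prednK.
by rewrite big_mkord -S1; apply: eq_bigr => i _; rewrite -SE.
Qed.

Lemma odometer_Omn (A : cstarAlgType R) (z S : A) : (0 < n)%N ->
  odometer m n z S -> Omn_relations m z (fun i : 'I_n => z ^+ i * S).
Proof.
move=> n0 odo; split.
- exact: odo_unitary odo.
- by move=> i; exact: (shifted_isometry odo).
- by move=> i j /= ->; rewrite mulrA -exprS.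
- move=> i j /= -> jn; rewrite expr0 mul1r mulrA -exprS jn.
  exact: odo_shift odo.
by rewrite -(odo_sum odo) big_mkord.
Qed.

Section Universal.
Context (A : cstarAlgType R) (z : A) (S : 'I_n -> A) (hA : is_Omn m z S).
Context (n0 : (0 < n)%N).
Local Notation S0 := (S (Ordinal n0)).

Lemma universal (B : cstarAlgType R) (w T : B) : odometer m n w T ->
  exists f : {lrmorphism A -> B},
    [/\ forall x, f (star x) = star (f x), f z = w & f S0 = T].
Proof.
move=> /(odometer_Omn n0)/(Omn_universal hA) [f [fs fz fS]].
by exists f; split=> //; rewrite fS expr0 mul1r.
Qed.

Lemma generated_two : cstar_generated [set z; S0] = [set: A].
Proof.
apply/seteqP; split=> //; rewrite -(Omn_generated hA).
apply: generated_sub; first exact: generated_subalgebra.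
have [_ SE] := Omn_odometer n0 (Omn_rel hA).
have Gz : cstar_generated [set z; S0] z by move=> D [_ GD]; apply: GD; left.
have GS : cstar_generated [set z; S0] S0 by move=> D [_ GD]; apply: GD; right.
move=> _ [->//|[i _ <-]]; rewrite [S i]SE; elim: (val i) => [|j IH].
  by rewrite expr0 mul1r.
by rewrite exprS -mulrA; exact: (csubM (generated_subalgebra _) Gz IH).
Qed.

End Universal.

(** Induction on [k], dividing out [gcd(k, n)] by the Bezout argument for [m] and
  this gcd. *)
Lemma reduce_coprime (A : cstarAlgType R) (z S : A) k : (0 < m)%N -> (0 < n)%N ->
  coprime m n -> odometer m n z S -> (0 < k)%N ->
  exists k', [/\ (0 < k')%N, coprime k' n &
    cstar_generated [set z ^+ k; S] = cstar_generated [set z ^+ k'; S]].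
Proof.
move=> m0 n0 mn odo; have [b] := ubnP k; elim: b k => // b IH k.
rewrite ltnS => kb k0; have [kn|] := boolP (coprime k n); first by exists k.
rewrite /coprime; set p := gcdn k n => p1.
have p0 : (0 < p)%N by rewrite gcdn_gt0 k0.
have {}p1 : (1 < p)%N by case: (p) p0 p1 => [|[|]].
pose k1 := (k %/ p)%N; have kE : k = (p * k1)%N by rewrite mulnC divnK ?dvdn_gcdl.
have nE : n = (p * (n %/ p))%N by rewrite mulnC divnK ?dvdn_gcdr.
have k10 : (0 < k1)%N by move: k0; rewrite kE muln_gt0 => /andP[].
have k1b : (k1 < b)%N by apply: leq_trans kb; rewrite kE ltn_Pmull.
have [k' [k'0 k'n Gk']] := IH _ k1b k10; exists k'; split=> //; rewrite -Gk'.
have Gsub j := generated_subalgebra [set z ^+ j; S].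
have GS j : cstar_generated [set z ^+ j; S] S by move=> D [_ GD]; apply: GD; right.
have Gz j : cstar_generated [set z ^+ j; S] (z ^+ j) by move=> D [_ GD]; apply: GD; left.
have GX j x i : cstar_generated [set z ^+ j; S] x ->
    cstar_generated [set z ^+ j; S] (x ^+ i).
  move=> Gx; elim: i => [|i IHi]; last by rewrite exprS; exact: (csubM (Gsub j) Gx IHi).
  rewrite expr0 -(odo_isometry odo).
  exact: (csubM (Gsub j) (csub_star (Gsub j) (GS j)) (GS j)).
apply/seteqP; split; apply: generated_sub => // _ [->|->] //.
  by rewrite kE mulnC exprM; exact: GX.
have Gp i : cstar_generated [set z ^+ k; S] (z ^+ (k1 * (p * i))).
  by rewrite mulnA [(k1 * p)%N]mulnC -kE exprM; exact: GX.
have Gm i : cstar_generated [set z ^+ k; S] (z ^+ (k1 * (m * i))).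
  have -> : z ^+ (k1 * (m * i)) = star S * (z ^+ (n * (k1 * i)) * S).
    by rewrite shift_pow // mulrA (odo_isometry odo) mul1r mulnCA.
  apply: (csubM (Gsub k) (csub_star (Gsub k) (GS k))).
  apply: (csubM (Gsub k) _ (GS k)).
  by rewrite mulnCA {1}nE -mulnA; exact: Gp.
have : coprime m p by apply: coprime_dvdr mn; exact: dvdn_gcdr.
case: (egcdnP p m0) => u v uv _ /eqP mp; rewrite mp in uv.
have -> : z ^+ k1 = star (z ^+ (k1 * (p * v))) * z ^+ (k1 * (m * u)).
  have [zs _] : cstar_unitary (z ^+ (k1 * (p * v))) := zpow_unitary (odo_unitary odo) _%:Z.
  by rewrite [(m * u)%N]mulnC uv mulnDr muln1 exprD [(v * p)%N]mulnC mulrA zs mul1r.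
exact: (csubM (Gsub k) (csub_star (Gsub k) (Gp v)) (Gm u)).
Qed.

End Odometer.

Theorem proposition4p2 (R : realType) (m n : nat)
    (hm : (1 <= m)%N) (hn : (1 < n)%N) (hmn : coprime m n)
    (A : cstarAlgType R) (z : A) (S : 'I_n -> A) (hA : is_Omn m z S)
    (k : nat) (hk : (1 <= k)%N) :
  cstar_isomorphic
    (cstar_generated [set z ^+ k; S (Ordinal (ltnW hn))]) [set: A].
Proof.
set S0 := S _; have [odo _] := Omn_odometer (ltnW hn) (Omn_rel hA).
have [k' [k'0 k'n ->]] := reduce_coprime hm (ltnW hn) hmn odo hk.
have [f [fs fz fS]] := universal hA (ltnW hn) (odometer_pow (ltnW hn) k'n odo).
have gauge (t : R[i]) : `|t| = 1 -> exists g : {lrmorphism A -> A},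
    [/\ forall x, g (star x) = star (g x), g z = z & g S0 = t *: S0].
  by move=> t1; exact: (universal hA (ltnW hn) (odometer_gauge t1 odo)).
have iso := hom_isometric hn hmn odo k'0 fs fz fS gauge (generated_two hA (ltnW hn)).
have -> : cstar_generated [set z ^+ k'; S0] = range f.
  apply/seteqP; split.
    apply: generated_sub; first exact: range_subalgebra.
    by move=> _ [->|->]; [exists z|exists S0].
  move=> _ [x _ <-]; pose D := [set x | cstar_generated [set z ^+ k'; S0] (f x)].
  have DD : cstar_subalgebra D.
    apply: preimage_subalgebra (generated_subalgebra _) => // y.
    by rewrite iso.
  have : [set: A] `<=` D.
    rewrite -(generated_two hA (ltnW hn)); apply: generated_sub DD _.
    move=> _ [->|->]; rewrite /D /= ?fz ?fS => G [_ sub]; apply: sub.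
      by left.
    by right.
  exact.
have [g gK] : {g : A -> A & forall y, range f y -> f (g y) = y}.
  apply: (@choice _ _ (fun y x => range f y -> f x = y)) => y.
  by have [[x _ <-]|ny] := pselect (range f y); [exists x|exists 0].
have finj : injective f.
  move=> x y fxy; apply/subr0_eq/nrm0_eq0.
  by rewrite -iso rmorphB /= fxy subrr nrm0.
have gf x : g (f x) = x by apply: finj; rewrite gK //; exists x.
exists g; split.
- move=> a _ _ [x _ <-] [y _ <-].
  by rewrite !gf -[RHS]gf linearP.
- by move=> _ _ [x _ <-] [y _ <-]; rewrite !gf -rmorphM gf.
- by move=> _ [x _ <-]; rewrite gf -fs gf.
split=> //.
- by move=> _ _ /set_mem [x _ <-] /set_mem [y _ <-]; rewrite !gf => ->.
- by move=> x _; exists (f x); [exists x|rewrite gf].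
Qed.
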